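(* Let $n\ge 1$ and let $X_{A_n}$ be the complement of the toric arrangement associated to the root system $A_n$. Then the Poincar\'e polynomial of $X_{A_n}$ is $$P(X_{A_n},t)=\prod_{i=1}^n\bigl(1+(i+1)\cdot t\bigr).$$
   Context: Let $e_1,\dots,e_{n+1}$ be the standard basis of $\mathbb{R}^{n+1}$. The root system $A_n$ is $\Phi=\{e_i-e_j : 1\le i,j\le n+1,\ i\neq j\}$, and $M=\mathbb{Z}\langle\Phi\rangle$ is its $\mathbb{Z}$-linear span, a free $\mathbb{Z}$-module of rank $n$. Let $X=\mathrm{Hom}(M,\mathbb{C}^* )\cong(\mathbb{C}^* )^n$, and for $\alpha\in\Phi$ put $A_\alpha=\{\chi\in X : \chi(\alpha)=1\}$. The toric arrangement associated to $A_n$ is $\{A_\alpha\}_{\alpha\in\Phi}$, and its complement is $X_{A_n}=X\setminus\bigcup_{\alpha\in\Phi}A_\alpha$. The Poincar\'e polynomial is $P(X_{A_n},t)=\sum_{i\ge0}\dim H^i(X_{A_n})\,t^i$, with cohomology taken with rational coefficients. *)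

(* Defs.v *)
From HB Require Import structures.
From mathcomp Require Import all_boot all_order all_algebra.
From mathcomp Require Import all_classical all_reals all_analysis.
From mathcomp.real_closed Require Export complex.

Set Implicit Arguments.
Unset Strict Implicit.
Unset Printing Implicit Defensive.

Import Order.TTheory GRing.Theory Num.Theory.
Import numFieldNormedType.Exports.
Local Open Scope classical_set_scope.
Local Open Scope ring_scope.

(** * Singular cohomology with rational coefficients *)

Definition std_simplex (R : realType) (k : nat) : set 'rV[R]_k.+1 :=
  [set t | (forall j, 0 <= t 0 j) /\ \sum_j t 0 j = 1].
Arguments std_simplex : clear implicits.

(* [face_mx i t] inserts a zero at position [i]. *)
Definition face_mx (R : realType) (k : nat) (i : 'I_k.+2) (t : 'rV[R]_k.+1) :
    'rV[R]_k.+2 :=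
  \row_j oapp (t 0) 0 (unlift i j).

Lemma face_mx_simplex (R : realType) (k : nat) (i : 'I_k.+2)
  (t : std_simplex R k) : face_mx i (val t) \in std_simplex R k.+1.
Proof.
case: t => t /= /set_mem[t0 t1]; apply/mem_set; split.
  by move=> j; rewrite mxE; case: unliftP => //= j' _; exact: t0.
rewrite (bigD1_ord i) //= mxE unlift_none /= add0r -[RHS]t1.
by apply: eq_bigr => j _; rewrite mxE liftK.
Qed.

Definition face (R : realType) (k : nat) (i : 'I_k.+2) (t : std_simplex R k) :
    std_simplex R k.+1 :=
  exist _ (face_mx i (val t)) (face_mx_simplex i t).

Lemma face_continuous (R : realType) (k : nat) (i : 'I_k.+2) :
  continuous (@face R k i).
Proof.
apply: continuous_comp_initial.
have -> : set_val \o @face R k i = @face_mx R k i \o set_val by [].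
move=> t; apply: continuous_comp; first exact: initial_continuous.
move=> A [B B_nbhs sBA].
pose C (i0 : 'I_1) (j' : 'I_k.+1) := B 0 (lift i j').
exists C => [i0 j'|s Cs /=].
  by have := B_nbhs 0 (lift i j'); rewrite mxE liftK (ord1 i0).
apply: sBA => i0 j; rewrite (ord1 i0) mxE.
case: unliftP => [j' ->|-> /=]; first exact: Cs.
by have /nbhs_singleton := B_nbhs 0 i; rewrite mxE unlift_none.
Qed.

Section SingularCohomology.
Variables (R : realType) (T : topologicalType).

Definition singular_simplex (k : nat) : Type :=
  continuousType (std_simplex R k) T.

Definition simplex_face (k : nat) (i : 'I_k.+2) (s : singular_simplex k.+1) :
    singular_simplex k :=
  s \o mkcts (@face_continuous R k i).

(* Rational cochains on the free module of singular chains, given by their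
   values on the basis of singular simplices. *)
Definition cochain (k : nat) := singular_simplex k -> rat^o.

Definition coboundary (k : nat) (phi : cochain k) : cochain k.+1 :=
  fun s => \sum_(i < k.+2) (-1) ^+ i * phi (simplex_face i s).

Definition cocycles (k : nat) : set (cochain k) :=
  [set phi | coboundary phi = 0].

Definition coboundaries (k : nat) : set (cochain k) :=
  match k with
  | 0 => [set 0]
  | j.+1 => range (@coboundary j)
  end.

End SingularCohomology.

(* [quotient_dim Z B d]: for subspaces [B] of [Z], the classes modulo [B] of
   some [d] elements of [Z] form a basis of [Z / B], i.e. [dim (Z / B) = d]. *)
Definition quotient_dim (F : fieldType) (V : lmodType F) (Z B : set V)
    (d : nat) : Prop :=
  exists b : 'I_d -> V, (forall i, Z (b i)) /\
    forall z, Z z -> exists! a : {ffun 'I_d -> F}, B (z - \sum_i a i *: b i).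

(* dim_Q H^k(T; Q) = d *)
Definition cohomology_dim (R : realType) (T : topologicalType) (k d : nat) :
    Prop :=
  quotient_dim (@cocycles R T k) (@coboundaries R T k) d.

(* In particular, every H^k is finite dimensional, and zero for large k. *)
Definition is_poincare_polynomial (R : realType) (T : topologicalType)
    (p : {poly nat}) : Prop :=
  forall k, cohomology_dim R T k (p`_k)%R.

(** * Toric arrangements *)

Definition in_Zspan (V : zmodType) (Phi : set V) : {pred V} :=
  fun v => `[< exists m (a : 'I_m -> V) (c : 'I_m -> int),
    (forall i, Phi (a i)) /\ v = \sum_(i < m) a i *~ c i >].

Lemma in_Zspan_closed (V : zmodType) (Phi : set V) :
  zmod_closed (in_Zspan Phi).
Proof.
split; first by apply/asboolP; exists 0%N, (fun=> 0), (fun=> 0);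
  split=> [[]//|]; rewrite big_ord0.
move=> _ _ /asboolP[m [a [c [aP ->]]]] /asboolP[p [b [d [bP ->]]]].
apply/asboolP; exists (m + p)%N.
exists (fun i => match fintype.split i with inl j => a j | inr j => b j end).
exists (fun i => match fintype.split i with inl j => c j | inr j => - d j end).
split=> [i|]; first by case: (fintype.split i).
rewrite big_split_ord /= -sumrN; congr (_ + _); apply: eq_bigr => i _.
  by have /= -> := unsplitK (inl i : 'I_m + 'I_p).
by have /= -> := unsplitK (inr i : 'I_m + 'I_p); rewrite mulrNz.
Qed.

HB.instance Definition _ (V : zmodType) (Phi : set V) :=
  GRing.isZmodClosed.Build V (in_Zspan Phi) (@in_Zspan_closed V Phi).

Record Zspan (V : zmodType) (Phi : set V) :=
  MkZspan { Zspan_val : V; _ : Zspan_val \in in_Zspan Phi }.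

HB.instance Definition _ (V : zmodType) (Phi : set V) :=
  [isSub for @Zspan_val V Phi].
HB.instance Definition _ (V : zmodType) (Phi : set V) :=
  [Choice of Zspan Phi by <:].
HB.instance Definition _ (V : zmodType) (Phi : set V) :=
  [SubChoice_isSubZmodule of Zspan Phi by <:].

Section ToricArrangement.
Variables (R : realType) (V : zmodType) (Phi : set V).

(* [R[i]^o] is [R[i]] with its usual topology; C-valued functions on the
   lattice carry the topology of pointwise convergence, which restricts to the
   usual topology of the torus Hom(M, C^* ). *)
Definition torus : set {ptws Zspan Phi -> R[i]^o} :=
  [set chi | (forall x, chi x != 0) /\
             (forall x y, chi (x + y) = chi x * chi y)].

Definition toric_hypersurface (alpha : Zspan Phi) :
    set {ptws Zspan Phi -> R[i]^o} :=
  [set chi | torus chi /\ chi alpha = 1].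

Definition toric_complement : set {ptws Zspan Phi -> R[i]^o} :=
  torus `\` \bigcup_(alpha in [set x : Zspan Phi | Phi (val x)])
              toric_hypersurface alpha.

End ToricArrangement.
Arguments toric_complement R {V} Phi.

Definition root_system_A (R : realType) (n : nat) : set 'rV[R]_n.+1 :=
  [set v | exists i j : 'I_n.+1, i != j /\ v = delta_mx 0 i - delta_mx 0 j].
Arguments root_system_A : clear implicits.

Definition X_A (R : realType) (n : nat) : topologicalType :=
  set_type (toric_complement R (root_system_A R n)).

(* Main.v *)
Require Import Defs.
From mathcomp Require Import all_boot all_order all_algebra.
From mathcomp Require Import all_classical all_reals all_analysis.
From mathcomp Require Import ring zify.

(** The evaluations at the roots [e_i - e_0] identify [X_A R n] with the space
    of injective sequences [z_0 = 0, z_1 = 1, z_2, ..., z_(n+1)] of complex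
    numbers, that is, with the configurations of [n] ordered points in the plane
    minus two points.  The Betti numbers are computed by adding the points one
    at a time, and, for each new point [z_m], by forbidding one after the other
    the collisions [z_m = z_0], ..., [z_m = z_(m-1)].

    All the spaces involved are subsets of one space of complex sequences, in
    which the coordinates of the points that have not been added yet are free.
    Let [A] be the space of configurations of [m] points, [E] the part of [A]
    where [z_m] avoids [z_0, ..., z_(j-1)], and [D] the part where [z_m] avoids
    [z_j].  Since the first [m] points are distinct, [A = E `|` D].  Moving [z_m]
    to [z_j + 1] deforms [A] into [D], so that [H(A) -> H(D)] is injective, and
    the Mayer-Vietoris sequence of the cover [E, D] splits into short exact
    sequences
      [0 -> H^k(A) -> H^k(E) + H^k(D) -> H^k(E `&` D) -> 0].
    Thus [H^k(E `&` D)] is [H^k(E)] plus the cokernel of [H^k(A) -> H^k(D)]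
    ([dim_restricted_classes], [dim_new_classes]).  To find the cokernel, cover
    [D] by the two parts where [z_m - z_j] avoids the closed negative, resp.
    positive, real axis; their intersection consists of the two parts where
    [z_m - z_j] lies in the upper or in the lower half plane.  All four parts
    are fibrewise star-shaped over [A], so have the cohomology of [A], and a
    second use of Mayer-Vietoris identifies the cokernel with [H^(k-1)(A)]
    ([dim_angular_classes]).  Each forbidden collision therefore adds
    [dim H^(k-1)(A)] to [dim H^k], the [m] collisions multiply the Poincare
    polynomial by [1 + m t] ([cohomology_dim_conf]), and [m] runs from [2] to
    [n + 1].

    The two properties of singular cohomology used here are homotopy invariance
    ([deformation_inj], [deformation_surj]) and Mayer-Vietoris, which rests on
    the theorem of small simplices ([small_cocycle]).  Both come from one
    natural construction on affine simplices, the cone construction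
    ([cone_homotopy_residue]): it produces the prism operator as well as the
    barycentric subdivision with its homotopy to the identity.

    The cohomology of a subset [U] of [T] is expressed by the cochains of [T]
    itself: cocycles on [U] are the cochains whose coboundary vanishes on the
    simplices of [U], and likewise for coboundaries.  The restriction maps are
    then inclusions, and maps that are only defined up to choices, such as
    connecting homomorphisms, are handled as linear relations
    ([quotient_dim_relation]). *)

Set Implicit Arguments.
Unset Strict Implicit.
Unset Printing Implicit Defensive.
Import Order.TTheory GRing.Theory Num.Theory.
Import numFieldNormedType.Exports.
Local Open Scope classical_set_scope.
Local Open Scope ring_scope.

(** * Cochains on tuples of vertices and the cone construction *)

Section VertexCochains.
Variable P : Type.

(** An affine simplex is represented by the tuple of its vertices, which live in
    an arbitrary type: the formulas for cones and faces do not use convexity. *)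
Definition vcochain (j : nat) := ('I_j.+1 -> P) -> rat.

Definition vface j (v : 'I_j.+2 -> P) (i : 'I_j.+2) : 'I_j.+1 -> P :=
  v \o lift i.

Definition vcoboundary j (phi : vcochain j) : vcochain j.+1 :=
  fun v => \sum_(i < j.+2) (-1) ^+ i * phi (vface v i).

Definition vcone (b : P) j (u : 'I_j.+1 -> P) : 'I_j.+2 -> P :=
  fun i => oapp u b (unlift ord0 i).

Definition cocone (b : P) j (phi : vcochain j.+1) : vcochain j :=
  fun u => phi (vcone b u).

Lemma vcone0 (b : P) j (u : 'I_j.+1 -> P) : vface (vcone b u) ord0 = u.
Proof. by apply/funext => i; rewrite /vface /vcone /= liftK. Qed.

Lemma vconeS (b : P) j (u : 'I_j.+2 -> P) (i : 'I_j.+2) :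
  vface (vcone b u) (lift ord0 i) = vcone b (vface u i).
Proof.
apply/funext => a; rewrite /vface /vcone /=.
case: (unliftP ord0 a) => [a' ->|->] /=.
  have -> : lift (lift ord0 i) (lift ord0 a') = lift ord0 (lift i a').
    by apply: val_inj; rewrite /= /bump !leq0n !add1n ltnS addnS.
  by rewrite liftK.
have -> : lift (lift ord0 i) ord0 = ord0 by apply: val_inj.
by rewrite unlift_none.
Qed.

Lemma vconeS0 (b : P) (u : 'I_1 -> P) (i : 'I_1) :
  vface (vcone b u) (lift ord0 i) = fun=> b.
Proof.
apply/funext => a; rewrite /vface /vcone /= (ord1 a) (ord1 i).
have -> : lift (lift ord0 (ord0 : 'I_1)) (ord0 : 'I_1) = ord0 by apply: val_inj.
by rewrite unlift_none.
Qed.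

(** Dual to [d (b . u) = u - b . d u], for the cone [b . u] over a simplex [u]. *)
Lemma cocone_vcoboundary (b : P) j (phi : vcochain j.+1) :
  cocone b (vcoboundary phi) = phi - vcoboundary (cocone b phi).
Proof.
apply/funext => u; rewrite /cocone /vcoboundary big_ord_recl /= expr0 mul1r vcone0.
congr (_ + _); rewrite -[RHS]/(- \sum_(i < _) _) -sumrN; apply: eq_bigr => i _.
by rewrite vconeS /bump /= add1n exprS mulN1r mulNr.
Qed.

(** In dimension 0 the face opposite to [u] in the segment [b . u] is the apex. *)
Lemma cocone_vcoboundary0 (b : P) (phi : vcochain 0) :
  cocone b (vcoboundary phi) = phi - (fun=> phi (fun=> b)).
Proof.
apply/funext => u; rewrite /cocone /vcoboundary big_ord_recl /= expr0 mul1r vcone0.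
congr (_ + _); rewrite big_ord1 vconeS0 /bump /= add1n expr1 mulN1r.
by [].
Qed.

Lemma lift_lift j (h : 'I_j.+3) (k : 'I_j.+2) (a : 'I_j.+1) : (k < h)%N ->
  forall (h' : 'I_j.+3) (k' : 'I_j.+2), h' = k :> nat -> h = k'.+1 :> nat ->
  lift h (lift k a) = lift h' (lift k' a).
Proof.
move=> kh h' k' e1 e2; apply: val_inj => /=; rewrite e1 e2 /bump.
move: kh; rewrite e2 ltnS; do 4![case: leqP => ? /=]; lia.
Qed.

(** The involution on pairs of successive face operators under which the terms
    of the double coboundary cancel: it exchanges the two ways to delete the
    same two vertices. *)
Definition swap_faces j (p : 'I_j.+3 * 'I_j.+2) : 'I_j.+3 * 'I_j.+2 :=
  if (p.2 < p.1)%N then (inord p.2, inord p.1.-1) else (inord p.2.+1, inord p.1).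

Lemma swap_facesK j : involutive (@swap_faces j).
Proof.
move=> [h k]; rewrite /swap_faces /=; case: (ltnP k h) => hk /=.
  have hk' : (h.-1 < j.+2)%N by have := ltn_ord h; lia.
  have e : (h.-1).+1 = h by rewrite prednK //; lia.
  have kj : (k < j.+3)%N by exact: ltnW (ltn_ord k).
  rewrite !inordK // ltnNge (_ : k <= h.-1)%N /=; last by lia.
  by congr pair; apply: val_inj; rewrite /= inordK ?e.
have hj : (h < j.+2)%N by apply: leq_ltn_trans hk (ltn_ord k).
have kj : (k.+1 < j.+3)%N by rewrite ltnS.
rewrite !inordK // (_ : (h < k.+1)%N) /=; last by rewrite ltnS.
by congr pair; apply: val_inj; rewrite /= inordK.
Qed.

Lemma vcoboundaryK j (phi : vcochain j) : vcoboundary (vcoboundary phi) = 0.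
Proof.
apply/funext => v; rewrite /vcoboundary.
under eq_bigr do rewrite big_distrr /=.
rewrite pair_big /=.
set S := LHS.
suff /eqP : S *+ 2 = 0 by rewrite mulrn_eq0 /= => /eqP.
rewrite mulr2n {1}/S (reindex_inj (inv_inj (@swap_facesK j))) /= /S -big_split /=.
apply: big1 => -[h k] _; rewrite /swap_faces /=; case: ltnP => hk /=.
  have e : (h.-1).+1 = h by rewrite prednK //; lia.
  have hk' : (h.-1 < j.+2)%N by rewrite -ltnS e; exact: ltn_ord.
  have kj : (k < j.+3)%N by exact: ltnW (ltn_ord k).
  have -> : vface (vface v (inord k)) (inord h.-1) = vface (vface v h) k.
    by apply/funext => a; congr v; symmetry; apply: lift_lift; rewrite /= ?inordK.
  rewrite !inordK // -[in X in _ + X]e exprS.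
  ring.
have hj : (h < j.+2)%N by apply: leq_ltn_trans hk (ltn_ord k).
have kj : (k.+1 < j.+3)%N by rewrite ltnS.
have -> : vface (vface v (inord k.+1)) (inord h) = vface (vface v h) k.
  by apply/funext => a; congr v; apply: lift_lift; rewrite /= ?inordK ?ltnS.
rewrite !inordK // exprS.
ring.
Qed.

Lemma vcoboundaryB j (phi psi : vcochain j) :
  vcoboundary (phi - psi) = vcoboundary phi - vcoboundary psi.
Proof.
apply/funext => v; rewrite /vcoboundary [RHS]/(_ - _).
rewrite -[RHS]/(_ - _) -sumrB; apply: eq_bigr => i _.
by rewrite -mulrBr.
Qed.

Lemma vcoboundaryD j (phi psi : vcochain j) :
  vcoboundary (phi + psi) = vcoboundary phi + vcoboundary psi.
Proof.
apply/funext => v; rewrite /vcoboundary.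
rewrite -[RHS]/(_ + _) -big_split; apply: eq_bigr => i _.
by rewrite /= -mulrDr.
Qed.

End VertexCochains.

Section ConeHomotopy.
Variables P Q : Type.
Variable G : forall j, vcochain Q j -> vcochain P j.
Hypothesis GB : forall j (phi psi : vcochain Q j), G (phi - psi) = G phi - G psi.
Hypothesis Gd : forall j (phi : vcochain Q j),
  G (vcoboundary phi) = vcoboundary (G phi).
Variable apex : forall j, ('I_j.+1 -> P) -> Q.

(** Dual to the inductive definition [h v = b . (G v - h (d v))], where [b] is
    an apex chosen for [v] and [G] is a chain map from simplices with vertices
    in [P] to chains with vertices in [Q]. *)
Fixpoint cone_homotopy j : vcochain Q j.+1 -> vcochain P j :=
  match j with
  | 0 => fun phi v => G (cocone (apex v) phi) v
  | i.+1 => fun phi v => G (cocone (apex v) phi) v -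
      vcoboundary (cone_homotopy (cocone (apex v) phi)) v
  end.

(** What is left of [G] after subtracting the boundary of [cone_homotopy]; dual
    to [r v = b . r (d v)].  For [G = id] and [b] the barycentre of [v], this is
    the inductive definition of the barycentric subdivision. *)
Fixpoint cone_residue j : vcochain Q j -> vcochain P j :=
  match j with
  | 0 => fun phi v => G (fun=> phi (fun=> apex v)) v
  | i.+1 => fun phi v =>
      vcoboundary (cone_residue (cocone (apex v) phi)) v
  end.

Lemma cone_homotopyB j (phi psi : vcochain Q j.+1) :
  cone_homotopy (phi - psi) = cone_homotopy phi - cone_homotopy psi.
Proof.
elim: j => [|j IH] in phi psi *; apply/funext => v /=.
  by rewrite -[cocone _ (_ - _)]/(cocone _ _ - cocone _ _) GB.
rewrite -[cocone _ (_ - _)]/(cocone _ _ - cocone _ _) GB IH vcoboundaryB.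
rewrite -[RHS]/(_ - _) -[(G _ - G _) v]/(_ - _).
rewrite -[(vcoboundary _ - vcoboundary _) v]/(_ - _).
ring.
Qed.

Definition cone_homotopy_boundary j : vcochain Q j -> vcochain P j :=
  match j with
  | 0 => fun=> 0
  | i.+1 => fun phi => vcoboundary (cone_homotopy phi)
  end.

(** By induction on the dimension, with [cocone_vcoboundary]: as
    [b . (G v - h (d v))] has boundary [G v - h (d v) - b . d (G v - h (d v))],
    the operator [G - d h - h d] satisfies the recursion of [cone_residue].
    The single identity provides both the subdivision operator, with its
    homotopy to the identity, and the prism operator, whose residue is zero. *)
Lemma cone_homotopy_residue j (phi : vcochain Q j) :
  G phi = cone_homotopy_boundary phi + cone_homotopy (vcoboundary phi) + cone_residue phi.
Proof.
elim: j => [|j IH] in phi *; apply/funext => v; rewrite -[RHS]/(_ + _ + _) /=.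
  rewrite cocone_vcoboundary0 GB -[(G _ - G _) v]/(_ - _).
  by rewrite add0r subrK.
rewrite cocone_vcoboundary GB Gd cone_homotopyB vcoboundaryB.
set phib := cocone _ _.
rewrite -[LHS]/(_) -[(G _ - _) v]/(_ - _) -[(vcoboundary _ - _) v]/(_ - _) (IH phib).
rewrite !vcoboundaryD.
have -> : vcoboundary (cone_homotopy_boundary phib) = 0.
  case: (j) phib => [|i] phib /=; last exact: vcoboundaryK.
  by apply/funext => w; rewrite /vcoboundary big1 // => i _; rewrite mulr0.
rewrite -![(_ + _) v]/(_ + _).
change ((0 : vcochain P j.+1) v) with (0 : rat).
rewrite /vcoboundary; ring.
Qed.
End ConeHomotopy.

Section ConeHomotopyLinear.
Variables P Q : Type.
Variable G : forall j, vcochain Q j -> vcochain P j.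
Variable apex : forall j, ('I_j.+1 -> P) -> Q.

(** If [G] has augmentation zero, then so does the residue in dimension 0, and
    the recursion propagates this to all dimensions. *)
Lemma cone_residue_eq0 :
  (forall (c : rat) (v : 'I_1 -> P), G (fun=> c) v = 0) ->
  forall j (phi : vcochain Q j), cone_residue G apex phi = 0.
Proof.
move=> G0; elim=> [|j IH] phi; apply/funext => v /=; first exact: G0.
by rewrite IH /vcoboundary big1 // => i _; rewrite mulr0.
Qed.

Lemma cone_homotopy0 : (forall j, @G j 0 = 0) ->
  forall j, cone_homotopy G apex (0 : vcochain Q j.+1) = 0.
Proof.
move=> G0; elim=> [|j IH]; apply/funext => v /=.
  by rewrite -[cocone _ _]/(0 : vcochain Q 0) G0.
rewrite -[cocone _ _]/(0 : vcochain Q j.+1) G0 IH /vcoboundary big1 ?subr0 //.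
by move=> i _; rewrite mulr0.
Qed.

Lemma cone_residue0 : (forall j, @G j 0 = 0) ->
  forall j, cone_residue G apex (0 : vcochain Q j) = 0.
Proof.
move=> G0; elim=> [|j IH]; apply/funext => v /=.
  by rewrite -[fun=> _]/(0 : vcochain Q 0) G0.
rewrite -[cocone _ _]/(0 : vcochain Q j) IH /vcoboundary big1 //.
by move=> i _; rewrite mulr0.
Qed.

Variables P' Q' : Type.
Variable G' : forall j, vcochain Q' j -> vcochain P' j.
Variable apex' : forall j, ('I_j.+1 -> P') -> Q'.
Variables (g : P -> P') (h : Q -> Q').
Hypothesis HG : forall j (phi : vcochain Q' j) u,
  G' phi (g \o u) = G (fun w => phi (h \o w)) u.
Hypothesis Hapex : forall j (u : 'I_j.+1 -> P), apex' (g \o u) = h (apex u).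

Lemma cocone_natural (b : Q) j (phi : vcochain Q' j.+1) :
  (fun w : 'I_j.+1 -> Q => cocone (h b) phi (h \o w)) =
  cocone b (fun w => phi (h \o w)).
Proof.
apply/funext => w; rewrite /cocone; congr phi; apply/funext => i.
by rewrite /vcone /=; case: unlift.
Qed.

Lemma cone_homotopy_natural j (phi : vcochain Q' j.+1) u :
  cone_homotopy G' apex' phi (g \o u) =
  cone_homotopy G apex (fun w => phi (h \o w)) u.
Proof.
elim: j => [|j IH] in phi u *; rewrite /= Hapex HG cocone_natural //.
congr (_ - _); apply: eq_bigr => i _; congr (_ * _).
by rewrite -[vface _ _]/(g \o vface u i) IH cocone_natural.
Qed.

Lemma cone_residue_natural j (phi : vcochain Q' j) u :
  cone_residue G' apex' phi (g \o u) = cone_residue G apex (fun w => phi (h \o w)) u.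
Proof.
elim: j => [|j IH] in phi u *; rewrite /= Hapex.
  by rewrite HG.
apply: eq_bigr => i _; congr (_ * _).
by rewrite -[vface _ _]/(g \o vface u i) IH cocone_natural.
Qed.

End ConeHomotopyLinear.

(** * Affine maps between standard simplices *)

Lemma continuous_sum (R : realType) (T : topologicalType) (I : Type) (r : seq I)
    (f : I -> T -> R) :
  (forall i, continuous (f i)) -> continuous (fun t => \sum_(i <- r) f i t).
Proof.
move=> fc t; apply: (@cvg_big _ _ _ _ _ _ _ _ _ _ _ (nbhs_filter t)) => [|i _].
  exact: add_continuous.
exact: fc.
Qed.

Section AffineSimplices.
Variable R : realType.

Lemma simplex_ge0 k (t : std_simplex R k) i : 0 <= val t 0 i.
Proof. by case: t => t /= /set_mem[]. Qed.

Lemma simplex_sum1 k (t : std_simplex R k) : \sum_i val t 0 i = 1.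
Proof. by case: t => t /= /set_mem[]. Qed.

Lemma simplex1_sum (t : std_simplex R 1) : val t 0 ord0 + val t 0 ord_max = 1.
Proof.
rewrite -(simplex_sum1 t) big_ord_recl big_ord1.
by congr (_ + val t 0 _); apply: val_inj.
Qed.

Lemma aff_subproof j k (u : 'I_j.+1 -> std_simplex R k) (t : std_simplex R j) :
  \sum_i val t 0 i *: val (u i) \in std_simplex R k.
Proof.
apply/mem_set; split=> [a|].
  rewrite summxE sumr_ge0 // => i _.
  by rewrite mxE mulr_ge0 ?simplex_ge0.
under eq_bigr do rewrite summxE.
rewrite exchange_big /= -[RHS](simplex_sum1 t); apply: eq_bigr => i _.
under eq_bigr do rewrite mxE.
by rewrite -mulr_sumr simplex_sum1 mulr1.
Qed.

Definition aff j k (u : 'I_j.+1 -> std_simplex R k) (t : std_simplex R j) :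
    std_simplex R k :=
  exist _ (\sum_i val t 0 i *: val (u i)) (aff_subproof u t).

Lemma simplex_coord_continuous k (i : 'I_k.+1) :
  continuous (fun t : std_simplex R k => val t 0 i).
Proof.
move=> t.
have -> : (fun t : std_simplex R k => val t 0 i) =
  (fun v : 'rV[R]_k.+1 => v 0 i) \o set_val by [].
apply: continuous_comp; first exact: initial_continuous.
exact: coord_continuous.
Qed.

Lemma continuous_to_simplex (T : topologicalType) k (f : T -> std_simplex R k) :
  (forall i, continuous (fun t => val (f t) 0 i)) -> continuous f.
Proof.
move=> fc; apply: continuous_comp_initial => t A [B B_nbhs sBA].
suff : \forall x \near t, forall i j, B i j (val (f x) i j).
  by apply: filterS => x Bx; exact: sBA.
apply: filter_forall => i; apply: filter_forall => j.
rewrite (ord1 i); exact: (fc j t _ (B_nbhs 0 j)).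
Qed.

Lemma aff_continuous j k (u : 'I_j.+1 -> std_simplex R k) : continuous (aff u).
Proof.
apply: continuous_to_simplex => i.
have -> : (fun t => val (aff u t) 0 i) =
    (fun t : std_simplex R j => \sum_a val t 0 a * val (u a) 0 i).
  by apply/funext => t; rewrite /= summxE; apply: eq_bigr => a _; rewrite mxE.
apply: continuous_sum => a t; apply: (@cvgMr_tmp _ _ _ (nbhs_filter t)).
exact: simplex_coord_continuous.
Qed.

Lemma vert_subproof k (i : 'I_k.+1) : delta_mx 0 i \in std_simplex R k.
Proof.
apply/mem_set; split=> [j|]; first by rewrite mxE; case: eqP; case: eqP.
rewrite (bigD1 i) //= mxE !eqxx big1 ?addr0 // => j /negPf ji.
by rewrite mxE ji andbF.
Qed.

Definition vertex k (i : 'I_k.+1) : std_simplex R k :=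
  exist _ (delta_mx 0 i) (vert_subproof i).

Lemma centre_subproof k : const_mx k.+1%:R^-1 \in std_simplex R k.
Proof.
apply/mem_set; split=> [j|]; first by rewrite mxE.
under eq_bigr do rewrite mxE.
by rewrite sumr_const card_ord -[_ *+ _]mulr_natr mulVf.
Qed.

Definition centre k : std_simplex R k :=
  exist _ (const_mx k.+1%:R^-1) (centre_subproof k).

Lemma aff_comp i j k (u : 'I_j.+1 -> std_simplex R k)
    (w : 'I_i.+1 -> std_simplex R j) t : aff u (aff w t) = aff (aff u \o w) t.
Proof.
apply: val_inj => /=.
under eq_bigr do rewrite summxE scaler_suml.
rewrite exchange_big /=; apply: eq_bigr => a _.
by rewrite scaler_sumr; apply: eq_bigr => b _; rewrite mxE scalerA.
Qed.

Lemma aff_vert j k (u : 'I_j.+1 -> std_simplex R k) i : aff u (vertex i) = u i.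
Proof.
apply: val_inj => /=; rewrite (bigD1 i) //= mxE !eqxx scale1r big1 ?addr0 //.
by move=> a /negPf ai; rewrite mxE ai andbF scale0r.
Qed.

Lemma aff_id k (t : std_simplex R k) : aff (@vertex k) t = t.
Proof.
apply: val_inj => /=; apply/rowP => i; rewrite summxE (bigD1 i) //= mxE mxE !eqxx.
rewrite mulr1 big1 ?addr0 // => a /negPf ai; rewrite !mxE eq_sym ai andbF.
by rewrite mulr0.
Qed.

Lemma aff_face k (i : 'I_k.+2) (t : std_simplex R k) :
  aff (vface (@vertex k.+1) i) t = face i t.
Proof.
apply: val_inj => /=; apply/rowP => b; rewrite summxE mxE.
case: unliftP => [b' ->|->] /=.
  rewrite (bigD1 b') //= !mxE !eqxx mulr1 big1 ?addr0 // => a /negPf ab.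
  by rewrite !mxE (inj_eq lift_inj) eq_sym ab andbF mulr0.
by rewrite big1 // => a _; rewrite !mxE (negPf (neq_lift i a)) andbF mulr0.
Qed.

Lemma aff_cst j k (p : std_simplex R k) (t : std_simplex R j) :
  aff (fun=> p) t = p.
Proof.
by apply: val_inj => /=; rewrite -scaler_suml simplex_sum1 scale1r.
Qed.

End AffineSimplices.

(** * Subdivision and prism operators on singular cochains *)

Section NaturalOperators.
Variables (R : realType) (T : topologicalType).

Definition restrict j k (s : singular_simplex R T k)
    (u : 'I_j.+1 -> std_simplex R k) : singular_simplex R T j :=
  s \o mkcts (@aff_continuous R j k u).

(** The affine cochain seen by a singular simplex [s].  An operator that is
    defined on [pull s phi] for all [s] and is natural for affine maps commutes
    with [pull] itself; this reduces all identities below to affine simplices. *)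
Definition pull k (s : singular_simplex R T k) j (phi : cochain R T j) :
    vcochain (std_simplex R k) j :=
  fun u => phi (restrict s u).

Definition lies_in (A : set T) k (s : singular_simplex R T k) := forall t, A (s t).

Lemma restrict_comp i j k (s : singular_simplex R T k)
    (u : 'I_j.+1 -> std_simplex R k) (w : 'I_i.+1 -> std_simplex R j) :
  restrict (restrict s u) w = restrict s (aff u \o w).
Proof. by apply/continuousEP => t /=; rewrite /mkcts aff_comp. Qed.

Lemma restrict_vert k (s : singular_simplex R T k) : restrict s (@vertex R k) = s.
Proof. by apply/continuousEP => t /=; rewrite /mkcts aff_id. Qed.

Lemma restrict_face k (s : singular_simplex R T k.+1) i :
  restrict s (vface (@vertex R k.+1) i) = simplex_face i s.
Proof. by apply/continuousEP => t /=; rewrite /mkcts aff_face. Qed.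

Lemma aff_vertE j k (u : 'I_j.+1 -> std_simplex R k) : aff u \o @vertex R j = u.
Proof. by apply/funext => i /=; rewrite aff_vert. Qed.

Lemma lies_in_restrict A j k (s : singular_simplex R T k)
    (u : 'I_j.+1 -> std_simplex R k) : lies_in A s -> lies_in A (restrict s u).
Proof. by move=> As t; exact: As. Qed.

Lemma lies_in_face A k (s : singular_simplex R T k.+1) i :
  lies_in A s -> lies_in A (simplex_face i s).
Proof. by move=> As t; exact: As. Qed.

Lemma pull_restrict k l (s : singular_simplex R T k)
    (u : 'I_l.+1 -> std_simplex R k) j (phi : cochain R T j) :
  pull (restrict s u) phi = fun w => pull s phi (aff u \o w).
Proof. by apply/funext => w; rewrite /pull restrict_comp. Qed.

Lemma pull_coboundary k (s : singular_simplex R T k) j (phi : cochain R T j) :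
  pull s (coboundary phi) = vcoboundary (pull s phi).
Proof.
apply/funext => u; apply: eq_bigr => i _; congr (_ * phi _).
rewrite -restrict_face restrict_comp; congr restrict.
by apply/funext => a; rewrite /vface /= aff_vert.
Qed.

Lemma pull_vert k (s : singular_simplex R T k) (phi : cochain R T k) :
  pull s phi (@vertex R k) = phi s.
Proof. by rewrite /pull restrict_vert. Qed.

Lemma coboundaryK k (phi : cochain R T k) : coboundary (coboundary phi) = 0.
Proof.
by apply/funext => s; rewrite -pull_vert 2!pull_coboundary vcoboundaryK.
Qed.

Definition barycentre k j (u : 'I_j.+1 -> std_simplex R k) := aff u (centre R j).

Lemma barycentre_natural i k l (u : 'I_l.+1 -> std_simplex R k)
    (w : 'I_i.+1 -> std_simplex R l) :
  barycentre (aff u \o w) = aff u (barycentre w).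
Proof. by rewrite /barycentre aff_comp. Qed.

(** With apexes at the barycentres, the residue of the identity is the barycentric
    subdivision. *)
Definition vsd k j : vcochain (std_simplex R k) j -> vcochain (std_simplex R k) j :=
  cone_residue (fun j => id) (@barycentre k) (j := j).

Definition sd k (phi : cochain R T k) : cochain R T k :=
  fun s => vsd (pull s phi) (@vertex R k).

Definition sd_homotopy k (phi : cochain R T k.+1) : cochain R T k :=
  fun s => cone_homotopy (fun j => id) (@barycentre k) (pull s phi) (@vertex R k).

Lemma pull_sd k (s : singular_simplex R T k) j (phi : cochain R T j) :
  pull s (sd phi) = vsd (pull s phi).
Proof.
apply/funext => u; rewrite /pull /sd -/(pull _ _) pull_restrict.
rewrite /vsd -(cone_residue_natural (apex' := @barycentre k)
  (G' := fun j => id) (g := aff u)) ?aff_vertE //.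
by move=> *; exact: barycentre_natural.
Qed.

Lemma pull_sd_homotopy k (s : singular_simplex R T k) j (phi : cochain R T j.+1) :
  pull s (sd_homotopy phi) = cone_homotopy (fun j => id) (@barycentre k) (pull s phi).
Proof.
apply/funext => u; rewrite /pull /sd_homotopy -/(pull _ _) pull_restrict.
rewrite -(cone_homotopy_natural (apex' := @barycentre k)
  (G' := fun j => id) (g := aff u)) ?aff_vertE //.
by move=> *; exact: barycentre_natural.
Qed.

Lemma sd_homotopyE k (phi : cochain R T k.+1) :
  phi = coboundary (sd_homotopy phi) + sd_homotopy (coboundary phi) + sd phi.
Proof.
apply/funext => s; rewrite -[RHS]/(_ + _ + _).
rewrite -[in LHS]pull_vert -[X in _ = X + _ + _]pull_vert.
rewrite pull_coboundary pull_sd_homotopy /sd_homotopy pull_coboundary /sd.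
by rewrite {1}(@cone_homotopy_residue _ _ (fun j => id) _ _ (@barycentre k.+1) _ (pull s phi)).
Qed.

(** Kept apart from [sd_homotopyE] as there are no cochains of degree -1. *)
Lemma sd_homotopyE0 (phi : cochain R T 0) :
  phi = sd_homotopy (coboundary phi) + sd phi.
Proof.
apply/funext => s; rewrite -[RHS]/(_ + _).
rewrite -[in LHS]pull_vert /sd_homotopy pull_coboundary /sd.
rewrite {1}(@cone_homotopy_residue _ _ (fun j => id) _ _ (@barycentre 0) _ (pull s phi)) //.
by rewrite /= add0r.
Qed.

Variable H : T * std_simplex R 1 -> T.
Hypothesis H_continuous : continuous H.

Definition end_pt (e : 'I_2) k (x : std_simplex R k) : std_simplex R k * std_simplex R 1 :=
  (x, vertex R e).

Definition prism_map k (s : singular_simplex R T k) j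
    (w : 'I_j.+1 -> std_simplex R k * std_simplex R 1) (t : std_simplex R j) : T :=
  H (s (aff (fst \o w) t), aff (snd \o w) t).

Lemma prism_map_continuous k (s : singular_simplex R T k) j
    (w : 'I_j.+1 -> std_simplex R k * std_simplex R 1) : continuous (prism_map s w).
Proof.
move=> t; rewrite /prism_map.
apply: (@continuous_comp _ _ _ (fun t => (s (aff (fst \o w) t), aff (snd \o w) t)) H);
  last exact: H_continuous.
exact: (cvg_pair (FF := nbhs_filter t) (FG := nbhs_filter _) (FH := nbhs_filter _)
  (@cts_fun _ _ (restrict s (fst \o w)) t) (@aff_continuous _ _ _ (snd \o w) t)).
Qed.

(** The homotopy [H] restricted to the affine simplex with vertices [w] in the
    prism over [s]; the unit interval is the standard 1-simplex. *)
Definition prism_simplex k (s : singular_simplex R T k) j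
    (w : 'I_j.+1 -> std_simplex R k * std_simplex R 1) : singular_simplex R T j :=
  mkcts (@prism_map_continuous k s j w).

Definition prism_pull k (s : singular_simplex R T k) j (phi : cochain R T j) :
    vcochain (std_simplex R k * std_simplex R 1) j :=
  fun w => phi (prism_simplex s w).

(** The chain map whose cone homotopy is the prism operator. *)
Definition ends k j (phi : vcochain (std_simplex R k * std_simplex R 1) j) :
    vcochain (std_simplex R k) j :=
  fun v => phi (@end_pt ord_max k \o v) - phi (@end_pt ord0 k \o v).

Definition prism_apex k j (v : 'I_j.+1 -> std_simplex R k) := end_pt ord0 (v ord0).

Definition prism k (phi : cochain R T k.+1) : cochain R T k :=
  fun s => cone_homotopy (@ends k) (@prism_apex k) (prism_pull s phi) (@vertex R k).

Definition affx1 k l (u : 'I_l.+1 -> std_simplex R k)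
  (p : std_simplex R l * std_simplex R 1) := (aff u p.1, p.2).

Lemma prism_pull_restrict k l (s : singular_simplex R T k)
    (u : 'I_l.+1 -> std_simplex R k) j (phi : cochain R T j) :
  prism_pull (restrict s u) phi = fun w => prism_pull s phi (affx1 u \o w).
Proof.
apply/funext => w; congr phi; apply/continuousEP => t /=.
by rewrite /mkcts /prism_map /= /mkcts aff_comp.
Qed.

Lemma pull_prism k (s : singular_simplex R T k) j (phi : cochain R T j.+1) :
  pull s (prism phi) = cone_homotopy (@ends k) (@prism_apex k) (prism_pull s phi).
Proof.
apply/funext => u; rewrite /pull /prism prism_pull_restrict.
by rewrite -(cone_homotopy_natural (apex' := @prism_apex k)
  (G' := @ends k) (g := aff u)) ?aff_vertE.
Qed.

Lemma prism_pull_coboundary k (s : singular_simplex R T k) j (phi : cochain R T j) :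
  prism_pull s (coboundary phi) = vcoboundary (prism_pull s phi).
Proof.
apply/funext => u; apply: eq_bigr => i _; congr (_ * phi _).
apply/continuousEP => t /=; rewrite /mkcts /= /prism_map -aff_face !aff_comp.
by congr (H (s (aff _ t), aff _ t)); apply/funext => a /=; rewrite aff_vert.
Qed.

Lemma endsB k j (phi psi : vcochain (std_simplex R k * std_simplex R 1) j) :
  ends (phi - psi) = ends phi - ends psi.
Proof.
apply/funext => v; rewrite -[RHS]/(_ - _) /ends -![(phi - psi) _]/(_ - _).
ring.
Qed.

Lemma ends_vcoboundary k j (phi : vcochain (std_simplex R k * std_simplex R 1) j) :
  ends (vcoboundary phi) = vcoboundary (ends phi).
Proof.
apply/funext => v; rewrite /ends /vcoboundary -sumrB; apply: eq_bigr => i _.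
by rewrite -mulrBr.
Qed.

Definition end_map e k (s : singular_simplex R T k) : singular_simplex R T k :=
  prism_simplex s (@end_pt e k \o @vertex R k).

(** The two ends of the prism have the same augmentation. *)
Lemma prism_residue k (phi : vcochain (std_simplex R k * std_simplex R 1) k) :
  cone_residue (@ends k) (@prism_apex k) phi = 0.
Proof. by apply: cone_residue_eq0 => c v; rewrite /ends subrr. Qed.

Lemma prismE k (phi : cochain R T k.+1) s :
  phi (end_map ord_max s) - phi (end_map ord0 s) =
  coboundary (prism phi) s + prism (coboundary phi) s.
Proof.
have := cone_homotopy_residue (@endsB k.+1) (@ends_vcoboundary k.+1)
  (@prism_apex k.+1) (prism_pull s phi).
rewrite prism_residue addr0 => /(congr1 (fun f => f (@vertex R k.+1))).
rewrite {1}/ends /prism_pull -/(end_map _ s) -/(end_map _ s) => ->.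
rewrite -[LHS]/(_ + _); congr (_ + _).
  by rewrite -[RHS]pull_vert pull_coboundary pull_prism.
by rewrite /prism prism_pull_coboundary.
Qed.

Lemma prismE0 (phi : cochain R T 0) s :
  phi (end_map ord_max s) - phi (end_map ord0 s) = prism (coboundary phi) s.
Proof.
have := cone_homotopy_residue (@endsB 0) (@ends_vcoboundary 0)
  (@prism_apex 0) (prism_pull s phi).
rewrite prism_residue addr0 => /(congr1 (fun f => f (@vertex R 0))).
rewrite {1}/ends /prism_pull -/(end_map _ s) -/(end_map _ s) => ->.
by rewrite /= -[LHS]/(_ + _) add0r /prism prism_pull_coboundary.
Qed.

End NaturalOperators.

(** * The mesh of the subdivisions and the Lebesgue number *)

Section Mesh.
Variables (R : realType) (k : nat).
Local Notation D := (std_simplex R k).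

Definition mesh_le (d : R) j (u : 'I_j.+1 -> D) :=
  forall a b, `|val (u a) - val (u b)| <= d.

(** A substitute for the convex hull of the vertices of [v] that is large
    enough to contain it and small enough for estimates of diameters. *)
Definition ball_hull j (v : 'I_j.+1 -> D) (x : D) :=
  forall (y : 'rV[R]_k.+1) (r : R), (forall a, `|val (v a) - y| <= r) -> `|val x - y| <= r.

Lemma ball_hull_aff j (v : 'I_j.+1 -> D) t : ball_hull v (aff v t).
Proof.
move=> y r vr /=.
have yE : y = \sum_i val t 0 i *: y by rewrite -scaler_suml simplex_sum1 scale1r.
rewrite [in X in `|X|]yE -sumrB (le_trans (ler_norm_sum _ _ _)) //.
have rE : r = \sum_i val t 0 i * r by rewrite -mulr_suml simplex_sum1 mul1r.
rewrite [leRHS]rE.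
apply: ler_sum => i _; rewrite -scalerBr normrZ (ger0_norm (simplex_ge0 t i)).
exact: ler_wpM2l (simplex_ge0 t i) _ _ (vr i).
Qed.

Lemma ball_hull_face j (v : 'I_j.+2 -> D) i x :
  ball_hull (vface v i) x -> ball_hull v x.
Proof. by move=> vx y r vr; apply: vx => a; exact: vr. Qed.

(** Barycentric subdivision of a [j]-simplex multiplies diameters by at most
    [j / (j + 1)]. *)
Definition ratio j : R := j%:R / j.+1%:R.

Lemma ratio_ge0 j : 0 <= ratio j.
Proof. by rewrite divr_ge0. Qed.

Lemma ratio_lt1 j : ratio j < 1.
Proof. by rewrite ltr_pdivrMr ?ltr0n // mul1r ltr_nat. Qed.

Lemma ratioS j : ratio j <= ratio j.+1.
Proof.
rewrite ler_pdivlMr ?ltr0n // mulrAC ler_pdivrMr ?ltr0n // -!natrM ler_nat.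
lia.
Qed.

Lemma mesh_le_ge0 d j (u : 'I_j.+1 -> D) : mesh_le d u -> 0 <= d.
Proof. by move=> /(_ ord0 ord0); exact: le_trans. Qed.

(** The difference is the average of the [j + 1] vectors from [v a] to the
    vertices, one of which is zero. *)
Lemma barycentre_near_vertex j (v : 'I_j.+1 -> D) d a : mesh_le d v ->
  `|val (barycentre v) - val (v a)| <= ratio j * d.
Proof.
move=> vd; have d0 := mesh_le_ge0 vd.
have -> : val (barycentre v) - val (v a) =
    \sum_i j.+1%:R^-1 *: (val (v i) - val (v a)).
  under [RHS]eq_bigr do rewrite scalerBr.
  have e : \sum_(i < j.+1) j.+1%:R^-1 *: val (v a) = val (v a).
    by rewrite -scaler_suml sumr_const card_ord -[_ *+ _]mulr_natr mulVf ?pnatr_eq0 // scale1r.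
  rewrite sumrB e /=.
  by congr (_ - _); apply: eq_bigr => i _; rewrite mxE.
rewrite (bigD1 a) //= subrr scaler0 add0r (le_trans (ler_norm_sum _ _ _)) //.
have -> : ratio j * d = \sum_(i < j.+1 | i != a) (j.+1%:R^-1 * d).
  by rewrite sumr_const cardC1 card_ord -[RHS]mulr_natl mulrA.
apply: ler_sum => i _; rewrite normrZ ger0_norm ?invr_ge0 //.
by apply: ler_wpM2l; [rewrite invr_ge0|exact: vd].
Qed.

(** [vsd phi v] only involves the values of [phi] on small simplices: in the
    recursion, the barycentre is close to the whole hull of [v], and the other
    vertices belong to the subdivision of a face. *)
Lemma vsd_local j (phi : vcochain D j) v d : mesh_le d v ->
  (forall u, (forall a, ball_hull v (u a)) -> mesh_le (ratio j * d) u -> phi u = 0) ->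
  vsd phi v = 0.
Proof.
elim: j => [|j IH] in phi v *; rewrite /vsd /= => vd phi0.
  apply: phi0 => [a|a b]; first exact: ball_hull_aff.
  by rewrite subrr normr0 mulr_ge0 ?ratio_ge0 ?(mesh_le_ge0 vd).
rewrite /vcoboundary big1 // => i _.
rewrite -/(vsd _) IH ?mulr0 // => [a b|u uv ud]; first exact: vd.
have d0 := mesh_le_ge0 vd.
have bu x : `|val (barycentre v) - val (u x)| <= ratio j.+1 * d.
  rewrite distrC; apply: (ball_hull_face (uv x)) => a.
  rewrite distrC; exact: barycentre_near_vertex.
apply: phi0 => [a|a b]; rewrite /vcone.
  case: unliftP => [a' _|_] /=; first exact: ball_hull_face (uv a').
  exact: ball_hull_aff.
case: unliftP => [a' _|_]; case: unliftP => [b' _|_] /=.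
- by rewrite (le_trans (ud a' b')) // ler_wpM2r // ratioS.
- rewrite distrC; exact: bu.
- exact: bu.
- by rewrite subrr normr0 mulr_ge0 ?ratio_ge0.
Qed.

Lemma iter_vsd_local m j (phi : vcochain D j) v d : mesh_le d v ->
  (forall u, mesh_le (ratio j ^+ m * d) u -> phi u = 0) ->
  iter m (@vsd R k j) phi v = 0.
Proof.
elim: m => [|m IH] in v d *; first by rewrite expr0 mul1r => vd; exact.
move=> vd phi0; apply: (vsd_local vd) => u _ ud; apply: (IH _ _ ud) => w wd.
by apply: phi0; rewrite exprSr -mulrA.
Qed.

Lemma mesh_bounded : exists C : R, forall j (u : 'I_j.+1 -> D), mesh_le C u.
Proof.
pose B := \sum_i `|val (vertex R i : D)|.
have xB (x : D) : `|val x| <= B.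
  rewrite -[x]aff_id /= (le_trans (ler_norm_sum _ _ _)) //.
  apply: ler_sum => i _; rewrite normrZ ger0_norm ?simplex_ge0 //.
  rewrite ler_piMl // -(simplex_sum1 x) (bigD1 i) //= lerDl.
  by apply: sumr_ge0 => a _; exact: simplex_ge0.
exists (B + B) => j u a b; rewrite (le_trans (ler_normB _ _)) //.
by rewrite lerD.
Qed.

Lemma iter_vsd_eventually0 j (phi : vcochain D j) e : 0 < e ->
  (forall u, mesh_le e u -> phi u = 0) ->
  exists M, forall m, (M <= m)%N -> iter m (@vsd R k j) phi = 0.
Proof.
move=> e0 phi0; have [C Cu] := mesh_bounded.
have C1 : 0 < `|C| + 1 by rewrite ltr_pwDr.
have rho : `|ratio j| < 1 by rewrite ger0_norm ?ratio_ge0 ?ratio_lt1.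
have /(_ _ (nbhsx_ballx 0 (e / (`|C| + 1)) _))[|M _ HM] := cvg_expr rho.
  by rewrite divr_gt0.
exists M => m Mm; apply/funext => v; apply: (@iter_vsd_local _ _ _ _ (`|C| + 1)).
  move=> a b; apply: le_trans (Cu _ v a b) _.
  by rewrite (le_trans (ler_norm C)) // lerDl.
move=> u um; apply: phi0 => a b; apply: le_trans (um a b) _.
rewrite -ler_pdivlMr // ltW //; have := HM _ Mm.
rewrite /= /ball /= sub0r normrN; exact: le_lt_trans (ler_norm _).
Qed.

End Mesh.

Section Lebesgue.
Variables (R : realType).

Lemma std_simplex_compact k : compact (std_simplex R k).
Proof.
pose I01 (i : 'I_k.+1) : set R := `[0, 1]%classic.
apply: (@subclosed_compact _ _ [set v : 'rV[R]_k.+1 | forall i, I01 i (v ord0 i)]).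
- have -> : std_simplex R k = \bigcap_(i in [set: 'I_k.+1])
      ((fun v : 'rV[R]_k.+1 => v 0 i) @^-1` [set x | 0 <= x]) `&`
      ((fun v : 'rV[R]_k.+1 => \sum_j v 0 j) @^-1` [set x | x = 1]).
    apply/seteqP; split=> [v [v0 v1]|v [v0 v1]]; first by split=> // i _; exact: v0.
    by split=> // j; exact: (v0 j).
  apply: closedI.
    apply: closed_bigI => i _; apply: preimage_closed; last exact: closed_ge.
    by move=> x _; exact: coord_continuous.
  apply: preimage_closed; last exact: closed_eq.
  by move=> x _; apply: continuous_sum => i v; exact: coord_continuous.
- by apply: rV_compact => i; exact: segment_compact.
- move=> v [v0 v1] i /=; rewrite /I01 /= in_itv /= v0 /=.
  by rewrite -v1 (bigD1 i) //= lerDl sumr_ge0.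
Qed.

Lemma nbhs_simplex_ball k (x : std_simplex R k) (A : set (std_simplex R k)) :
  nbhs x A -> exists2 r : R, 0 < r & forall y, `|val x - val y| < r -> A y.
Proof.
case=> B [[C oC CB] Bx BA].
have Cx : C (val x) by rewrite -[C _]/((set_val @^-1` C) x) CB.
have /nbhs_ballP[r r0 rC] := open_nbhs_nbhs (conj oC Cx).
exists r => // y xy; apply: BA; rewrite -CB; apply: rC.
by rewrite -ball_normE.
Qed.

(** The radius is uniform by compactness of the simplex. *)
Lemma lebesgue_number k (O1 O2 : set (std_simplex R k)) :
  open O1 -> open O2 -> (forall x, O1 x \/ O2 x) ->
  exists2 e : R, 0 < e & forall x : std_simplex R k,
    (forall y, `|val x - val y| <= e -> O1 y) \/
    (forall y, `|val x - val y| <= e -> O2 y).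
Proof.
move=> oO1 oO2 cov.
pose P (e : R) (v : 'rV[R]_k.+1) := forall x : std_simplex R k, val x = v ->
    (forall y, `|val x - val y| <= e -> O1 y) \/
    (forall y, `|val x - val y| <= e -> O2 y).
have : \forall e \near (0 : R)^'+, std_simplex R k `<=` P e.
  apply: (proj1 (compact_near_coveringP _) (@std_simplex_compact k)) => v vK.
  pose x : std_simplex R k := exist _ v (mem_set vK).
  have [i Oix] : exists i : bool, (if i then O1 else O2) x.
    by have [?|?] := cov x; [exists true|exists false].
  have [r r0 rO] : exists2 r : R, 0 < r & forall y : std_simplex R k,
      `|v - val y| < r -> (if i then O1 else O2) y.
    apply: (@nbhs_simplex_ball _ x); apply: open_nbhs_nbhs; split=> //.
    by case: (i).
  near=> w e => y yw.
  have H z : `|val y - val z| <= e -> (if i then O1 else O2) z.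
    move=> yz; apply: rO.
    have -> : v - val z = (v - w) + (val y - val z) by rewrite yw addrA subrK.
    rewrite (le_lt_trans (ler_normD _ _)) // (splitr r) ltr_leD //.
      near: w; apply/nbhs_ballP; exists (r / 2); first by rewrite /= divr_gt0.
      by move=> w; rewrite -ball_normE.
    apply: (le_trans yz); near: e; apply: nbhs_right_le; by rewrite divr_gt0.
  by case: (i) H => H; [left|right].
move=> Hnear; near (0 : R)^'+ => e; exists e; first by near: e; exact: nbhs_right_gt.
move=> x; apply: (near Hnear e) => //.
exact: set_mem (valP x).
Unshelve. all: by end_near.
Qed.

End Lebesgue.

(** * Cocycles on a subset and small simplices *)

Section SmallSimplices.
Variables (R : realType) (T : topologicalType).
Implicit Types A U V : set T.

Definition vanishes A k (phi : cochain R T k) :=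
  forall s : singular_simplex R T k, lies_in A s -> phi s = 0.

(** Cocycles of the subspace [A]; together with [coboundary_on], which contains
    all the cochains that vanish on [A], they compute the cohomology of [A]. *)
Definition cocycle_on A k : set (cochain R T k) :=
  [set phi | vanishes A (coboundary phi)].

Definition coboundary_on A k : set (cochain R T k) :=
  match k with
  | 0 => [set phi | vanishes A phi]
  | j.+1 => [set phi | exists psi : cochain R T j, vanishes A (phi - coboundary psi)]
  end.

Lemma coboundary_linear k (a : rat) (phi psi : cochain R T k) :
  coboundary (a *: phi + psi) = a *: coboundary phi + coboundary psi.
Proof.
apply/funext => s; rewrite -[RHS]/(_ * _ + _) /coboundary mulr_sumr -big_split /=.
apply: eq_bigr => i _; rewrite -[(a *: phi + psi) _]/(a * _ + _).
by rewrite mulrDr mulrCA.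
Qed.

Lemma coboundaryD k (phi psi : cochain R T k) :
  coboundary (phi + psi) = coboundary phi + coboundary psi.
Proof. by rewrite -[phi]scale1r coboundary_linear !scale1r. Qed.

Lemma coboundary0 k : coboundary (0 : cochain R T k) = 0.
Proof. by apply/funext => s; rewrite /coboundary big1 // => i _; rewrite mulr0. Qed.

Lemma coboundaryN k (phi : cochain R T k) : coboundary (- phi) = - coboundary phi.
Proof.
have := coboundary_linear (-1) phi 0.
by rewrite !scaleN1r addr0 coboundary0 addr0.
Qed.

Lemma coboundaryB k (phi psi : cochain R T k) :
  coboundary (phi - psi) = coboundary phi - coboundary psi.
Proof. by rewrite coboundaryD coboundaryN. Qed.

Lemma vanishes_linear A k (a : rat) (phi psi : cochain R T k) :
  vanishes A phi -> vanishes A psi -> vanishes A (a *: phi + psi).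
Proof.
move=> p0 q0 s sA; rewrite -[LHS]/(a * phi s + psi s).
by rewrite p0 // q0 // mulr0 addr0.
Qed.

Lemma vanishesD A k (phi psi : cochain R T k) :
  vanishes A phi -> vanishes A psi -> vanishes A (phi + psi).
Proof. by rewrite -{2}[phi]scale1r; exact: vanishes_linear. Qed.

Lemma vanishesN A k (phi : cochain R T k) : vanishes A phi -> vanishes A (- phi).
Proof. by move=> p0 s sA; rewrite -[LHS]/(- phi s) p0 // oppr0. Qed.

Lemma vanishesB A k (phi psi : cochain R T k) :
  vanishes A phi -> vanishes A psi -> vanishes A (phi - psi).
Proof. by move=> p0 q0; apply: vanishesD => //; exact: vanishesN. Qed.

Lemma vanishes_sub A U k (phi : cochain R T k) :
  U `<=` A -> vanishes A phi -> vanishes U phi.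
Proof. by move=> UA p0 s sU; apply: p0 => t; apply: UA; exact: sU. Qed.

Lemma vanishes_coboundary A k (phi : cochain R T k) :
  vanishes A phi -> vanishes A (coboundary phi).
Proof.
move=> p0 s sA; rewrite /coboundary big1 // => i _.
by rewrite p0 ?mulr0 //; exact: lies_in_face.
Qed.

Lemma vanishes_pull A k (s : singular_simplex R T k) j (phi : cochain R T j) :
  vanishes A phi -> lies_in A s -> pull s phi = 0.
Proof.
by move=> p0 sA; apply/funext => u; apply: p0; exact: lies_in_restrict.
Qed.

Lemma vanishes_sd A k (phi : cochain R T k) : vanishes A phi -> vanishes A (sd phi).
Proof.
by move=> p0 s sA; rewrite /sd (vanishes_pull p0 sA) /vsd cone_residue0.
Qed.

Lemma vanishes_sd_homotopy A k (phi : cochain R T k.+1) :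
  vanishes A phi -> vanishes A (sd_homotopy phi).
Proof.
by move=> p0 s sA; rewrite /sd_homotopy (vanishes_pull p0 sA) cone_homotopy0.
Qed.

Lemma cocycle_sd A k (phi : cochain R T k) :
  cocycle_on A phi -> cocycle_on A (sd phi).
Proof.
move=> p0; rewrite /cocycle_on /=.
suff -> : coboundary (sd phi) = coboundary phi - coboundary (sd_homotopy (coboundary phi)).
  apply: vanishesB => //; apply: vanishes_coboundary; exact: vanishes_sd_homotopy.
case: k phi {p0} => [|k] phi; rewrite -coboundaryB.
  congr coboundary; apply/eqP; rewrite eq_sym subr_eq [sd _ + _]addrC.
  by apply/eqP; exact: sd_homotopyE0.
have -> : sd phi = phi - (coboundary (sd_homotopy phi) + sd_homotopy (coboundary phi)).
  apply/eqP; rewrite eq_sym subr_eq [sd _ + _]addrC.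
  by apply/eqP; exact: sd_homotopyE.
by rewrite opprD addrCA [LHS]coboundaryD [X in X + _]coboundaryN coboundaryK oppr0 add0r.
Qed.

Definition open_cover A U V :=
  exists G1 G2, [/\ open G1, open G2, U = A `&` G1, V = A `&` G2 & A `<=` G1 `|` G2].

Lemma open_cover_sub A U V : open_cover A U V -> U `<=` A /\ V `<=` A.
Proof.
by case=> G1 [G2 [_ _ -> -> _]]; split; exact: subIsetl.
Qed.

Lemma pull_iter_sd k (s : singular_simplex R T k) j (phi : cochain R T j) m :
  pull s (iter m (@sd R T j) phi) = iter m (@vsd R k j) (pull s phi).
Proof. by elim: m => //= m IH; rewrite pull_sd IH. Qed.

(** Enough subdivisions of a simplex of [A] lie in [U] or in [V], simplex by
    simplex; the number of subdivisions depends on [s]. *)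
Lemma sd_eventually_vanishes A U V : open_cover A U V ->
  forall j (phi : cochain R T j), vanishes U phi -> vanishes V phi ->
  forall k (s : singular_simplex R T k), lies_in A s ->
  exists M, forall m, (M <= m)%N -> pull s (iter m (@sd R T j) phi) = 0.
Proof.
move=> [G1 [G2 [oG1 oG2 -> -> cov]]] j phi U0 V0 k s sA.
have sc : continuous s by exact: cts_fun.
have [e e0 He] := @lebesgue_number _ k (s @^-1` G1) (s @^-1` G2)
  (open_comp (fun x _ => sc x) oG1) (open_comp (fun x _ => sc x) oG2)
  (fun x => cov _ (sA x)).
have pull0 u : mesh_le e u -> pull s phi u = 0.
  move=> ue; have ut t : `|val (u ord0) - val (aff u t)| <= e.
    by rewrite distrC; apply: ball_hull_aff => a; exact: ue.
  by have [H|H] := He (u ord0); [apply: U0|apply: V0] => t; split;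
    [exact: sA | exact: (H _ (ut t)) | exact: sA | exact: (H _ (ut t))].
have [M HM] := iter_vsd_eventually0 e0 pull0.
by exists M => m Mm; rewrite pull_iter_sd HM.
Qed.

Fixpoint sd_sum k (phi : cochain R T k.+1) m : cochain R T k :=
  if m is m'.+1 then sd_sum phi m' + sd_homotopy (iter m' (@sd R T _) phi) else 0.

(** A telescoping sum of the homotopies between successive subdivisions. *)
Lemma coboundary_sd_sum A k (phi : cochain R T k.+1) m : cocycle_on A phi ->
  vanishes A (coboundary (sd_sum phi m) - (phi - iter m (@sd R T _) phi)).
Proof.
move=> p0; elim: m => [|m IH] /=.
  by rewrite subrr subr0 coboundary0.
have Z : cocycle_on A (iter m (@sd R T k.+1) phi).
  by elim: (m) => //= m'; exact: cocycle_sd.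
rewrite coboundaryD; set f := iter m _ phi in IH Z *.
have E := sd_homotopyE f.
have -> : coboundary (sd_sum phi m) + coboundary (sd_homotopy f) - (phi - sd f) =
  coboundary (sd_sum phi m) - (phi - f) - sd_homotopy (coboundary f).
  rewrite {3}E; ring.
by apply: vanishesB => //; exact: vanishes_sd_homotopy.
Qed.

(** Theorem of small simplices.  The primitive of [phi] is the infinite sum of
    [sd_homotopy (sd^m phi)], which is finite on each simplex of [A]; it
    vanishes on [U] and [V] because subdivision preserves these subsets. *)
Theorem small_cocycle A U V k (phi : cochain R T k.+1) : open_cover A U V ->
  cocycle_on A phi -> vanishes U phi -> vanishes V phi ->
  exists psi : cochain R T k,
    [/\ vanishes U psi, vanishes V psi & vanishes A (phi - coboundary psi)].
Proof.
move=> cov p0 U0 V0; have [UA VA] := open_cover_sub cov.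
have /choice[M HM] (s : singular_simplex R T k) : exists M, lies_in A s ->
    forall m, (M <= m)%N -> pull s (iter m (@sd R T k.+1) phi) = 0.
  have [sA|nsA] := pselect (lies_in A s); last by exists 0%N.
  by have [M HM] := sd_eventually_vanishes cov U0 V0 sA; exists M.
have stable s : lies_in A s -> forall m, (M s <= m)%N -> sd_sum phi m s = sd_sum phi (M s) s.
  move=> sA; elim=> [|m IH]; first by rewrite leqn0 => /eqP ->.
  rewrite leq_eqVlt => /predU1P[<- //|]; rewrite ltnS => Mm.
  rewrite /= -[LHS]/(_ + _) IH // /sd_homotopy HM //.
  by rewrite cone_homotopy0 // addr0.
have van W m : vanishes W phi -> vanishes W (sd_sum phi m).
  move=> W0; elim: m => //= m IH; apply: vanishesD => //.
  apply: vanishes_sd_homotopy; elim: (m) => //= m'; exact: vanishes_sd.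
exists (fun s => sd_sum phi (M s) s); split=> [s sU|s sV|s sA].
- exact: (van U).
- exact: (van V).
have [M' HM'] := sd_eventually_vanishes cov U0 V0 sA.
(* one number of terms that suffices for [s] and for all its faces *)
pose N := (\max_i M (simplex_face i s) + M')%N.
have -> : (phi - coboundary (fun s => sd_sum phi (M s) s)) s =
    phi s - coboundary (sd_sum phi N) s.
  congr (_ - _); apply: eq_bigr => i _; congr (_ * _); symmetry; apply: stable.
    exact: lies_in_face.
  rewrite /N (leq_trans _ (leq_addr _ _)) //.
  exact: (@leq_bigmax _ (fun i : 'I_k.+2 => M (simplex_face i s)) i).
have := coboundary_sd_sum N p0 sA.
rewrite -[LHS]/(_ - (_ - _)) -[iter N _ _ s]pull_vert HM' ?leq_addl //.
by rewrite -[X in _ - (_ - X)]/0 subr0 => /eqP; rewrite subr_eq0 => /eqP ->; rewrite subrr.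
Qed.

(** In degree 0 a cocycle is invariant under subdivision. *)
Theorem small_cocycle0 A U V (phi : cochain R T 0) : open_cover A U V ->
  cocycle_on A phi -> vanishes U phi -> vanishes V phi -> vanishes A phi.
Proof.
move=> cov p0 U0 V0 s sA.
have [M /(_ M (leqnn M)) HM] := sd_eventually_vanishes cov U0 V0 sA.
suff -> : phi s = iter M (@sd R T 0) phi s by rewrite -pull_vert HM.
elim: (M) => //= m ->.
have Z : cocycle_on A (iter m (@sd R T 0) phi).
  by elim: (m) => //= m'; exact: cocycle_sd.
rewrite [in LHS](sd_homotopyE0 (iter m _ phi)) -[LHS]/(_ + _).
by rewrite (vanishes_sd_homotopy Z) ?add0r.
Qed.

End SmallSimplices.

(** * Mayer-Vietoris and homotopy invariance *)

Section MayerVietoris.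
Variables (R : realType) (T : topologicalType).
Implicit Types A U V : set T.
Local Notation Zc A k := (@cocycle_on R T A k).
Local Notation Bc A k := (@coboundary_on R T A k).

Lemma cocycle_on_linear A k a (phi psi : cochain R T k) :
  Zc A k phi -> Zc A k psi -> Zc A k (a *: phi + psi).
Proof.
by move=> ? ?; rewrite /cocycle_on /= coboundary_linear; exact: vanishes_linear.
Qed.

Lemma coboundary_on_linear A k a (phi psi : cochain R T k) :
  Bc A k phi -> Bc A k psi -> Bc A k (a *: phi + psi).
Proof.
case: k => [|k] in phi psi *; first exact: vanishes_linear.
move=> [e He] [g Hg]; exists (a *: e + g).
rewrite coboundary_linear opprD addrACA -scalerBr; exact: vanishes_linear.
Qed.

Lemma cocycle_onD A k (phi psi : cochain R T k) :
  Zc A k phi -> Zc A k psi -> Zc A k (phi + psi).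
Proof. by rewrite -{2}[phi]scale1r; exact: cocycle_on_linear. Qed.

Lemma coboundary_onD A k (phi psi : cochain R T k) :
  Bc A k phi -> Bc A k psi -> Bc A k (phi + psi).
Proof. by rewrite -{2}[phi]scale1r; exact: coboundary_on_linear. Qed.

Lemma vanishes_coboundary_on A k (phi : cochain R T k) : vanishes A phi -> Bc A k phi.
Proof.
case: k => [|k] in phi * => //= H; exists 0.
by rewrite coboundary0 subr0.
Qed.

Lemma vanishes0 A k : vanishes A (0 : cochain R T k).
Proof. by []. Qed.

Lemma cocycle_on0 A k : Zc A k 0.
Proof. exact: (vanishes_coboundary (@vanishes0 A k)). Qed.

Lemma coboundary_on0 A k : Bc A k 0.
Proof. exact: vanishes_coboundary_on. Qed.

Lemma cocycle_onN A k (phi : cochain R T k) : Zc A k phi -> Zc A k (- phi).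
Proof.
move=> p; rewrite -[- phi]addr0 -scaleN1r; apply: cocycle_on_linear => //.
exact: cocycle_on0.
Qed.

Lemma coboundary_onN A k (phi : cochain R T k) : Bc A k phi -> Bc A k (- phi).
Proof.
move=> p; rewrite -[- phi]addr0 -scaleN1r; apply: coboundary_on_linear => //.
exact: coboundary_on0.
Qed.

Lemma cocycle_onB A k (phi psi : cochain R T k) :
  Zc A k phi -> Zc A k psi -> Zc A k (phi - psi).
Proof. by move=> p q; apply: cocycle_onD => //; exact: cocycle_onN. Qed.

Lemma coboundary_onB A k (phi psi : cochain R T k) :
  Bc A k phi -> Bc A k psi -> Bc A k (phi - psi).
Proof. by move=> p q; apply: coboundary_onD => //; exact: coboundary_onN. Qed.

Lemma coboundary_onBC A k (phi psi : cochain R T k) :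
  Bc A k (phi - psi) -> Bc A k (psi - phi).
Proof. by move=> p; rewrite -opprB; exact: coboundary_onN. Qed.

Lemma coboundary_cocycle A k (phi : cochain R T k) : Bc A k phi -> Zc A k phi.
Proof.
case: k phi => [|k] phi /=; first exact: vanishes_coboundary.
case=> e /vanishes_coboundary; rewrite coboundaryB coboundaryK subr0; exact.
Qed.

Lemma cocycle_on_sub A U k : U `<=` A -> Zc A k `<=` Zc U k.
Proof. by move=> UA phi; exact: vanishes_sub. Qed.

Lemma coboundary_on_sub A U k : U `<=` A -> Bc A k `<=` Bc U k.
Proof.
move=> UA; case: k => [|k] phi; first exact: vanishes_sub.
by move=> [e He]; exists e; exact: vanishes_sub He.
Qed.

Lemma cocycle_coboundary A k (e : cochain R T k) : Zc A k.+1 (coboundary e).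
Proof. by rewrite /cocycle_on /= coboundaryK. Qed.

Lemma coboundary_on_coboundary A k (e : cochain R T k) : Bc A k.+1 (coboundary e).
Proof. by exists e; rewrite subrr. Qed.

Lemma cocycle_on_congr A k (phi psi : cochain R T k) :
  vanishes A (phi - psi) -> Zc A k psi -> Zc A k phi.
Proof.
move=> /vanishes_coboundary; rewrite coboundaryB => H Hp.
by rewrite /cocycle_on /= -[coboundary phi](subrK (coboundary psi)); exact: vanishesD.
Qed.

Lemma glue_cochains U V k (a b : cochain R T k) : vanishes (U `&` V) (a - b) ->
  exists g : cochain R T k, vanishes U (g - a) /\ vanishes V (g - b).
Proof.
move=> ab; exists (fun s => if pselect (lies_in U s) then a s else b s).
split=> s sX; rewrite -[LHS]/(_ - _); case: pselect => // sU; rewrite ?subrr //.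
by apply: ab => t; split; [exact: sU|exact: sX].
Qed.

(** Gluing the cochains produces a cochain whose coboundary vanishes on the
    simplices of [U] and of [V] only; small simplices correct it on [A]. *)
Lemma glue_cocycles A U V k (a b : cochain R T k) : open_cover A U V ->
  Zc U k a -> Zc V k b -> vanishes (U `&` V) (a - b) ->
  exists w, [/\ Zc A k w, vanishes U (w - a) & vanishes V (w - b)].
Proof.
move=> cov Za Zb /glue_cochains[g [ga gb]].
have [||psi [psiU psiV gpsi]] := small_cocycle cov (@cocycle_coboundary A _ g).
- exact: cocycle_on_congr ga Za.
- exact: cocycle_on_congr gb Zb.
exists (g - psi); split; last 2 first.
- by rewrite addrAC; exact: vanishesB.
- by rewrite addrAC; exact: vanishesB.
by rewrite /cocycle_on /= coboundaryB.
Qed.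

(** Exactness at [H(U) + H(V)]. *)
Lemma mayer_vietoris_glue A U V k (a b : cochain R T k) : open_cover A U V ->
  Zc U k a -> Zc V k b -> Bc (U `&` V) k (a - b) ->
  exists w, [/\ Zc A k w, Bc U k (w - a) & Bc V k (w - b)].
Proof.
move=> cov Za Zb Bab.
(* a coboundary changes [a] so that it agrees with [b] on the intersection *)
have [a' [Za' aa' a'b]] : exists a', [/\ Zc U k a', Bc U k (a' - a) &
    vanishes (U `&` V) (a' - b)].
  case: k a b Za Zb Bab => [|k] a b Za Zb.
    by exists a; split=> //; rewrite subrr; exact: coboundary_on0.
  case=> e He; exists (a - coboundary e); split.
  - by apply: cocycle_onB => //; exact: cocycle_coboundary.
  - rewrite addrAC subrr add0r; apply: coboundary_onN; exact: coboundary_on_coboundary.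
  - by rewrite addrAC.
have [w [Zw wa wb]] := glue_cocycles cov Za' Zb a'b.
exists w; split=> //; last exact: vanishes_coboundary_on.
rewrite -[w - a](subrKA a'); apply: coboundary_onD => //.
exact: vanishes_coboundary_on.
Qed.

(** Exactness at [H(A)]: [phi] is the image of the class of [u - v] under the
    connecting homomorphism. *)
Lemma mayer_vietoris_inj A U V k (phi : cochain R T k.+1) (u v : cochain R T k) :
  open_cover A U V -> Zc A k.+1 phi ->
  vanishes U (phi - coboundary u) -> vanishes V (phi - coboundary v) ->
  Bc (U `&` V) k (u - v) -> Bc A k.+1 phi.
Proof.
move=> cov Zphi Hu Hv Buv.
(* a coboundary changes [u] so that it agrees with [v] on the intersection *)
have [u' [Hu' u'v]] : exists u', vanishes U (phi - coboundary u') /\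
    vanishes (U `&` V) (u' - v).
  case: k phi u v Zphi Hu Hv Buv => [|k] phi u v _ Hu Hv; first by exists u.
  case=> e He; exists (u - coboundary e).
  by rewrite coboundaryB coboundaryK subr0; split=> //; rewrite addrAC.
have [g [gu gv]] := glue_cochains u'v.
have [|||psi [_ _ Hpsi]] := small_cocycle cov (phi := phi - coboundary g).
- by apply: cocycle_onB => //; exact: cocycle_coboundary.
- have -> : phi - coboundary g = (phi - coboundary u') - coboundary (g - u').
    by rewrite coboundaryB opprB addrA subrK.
  apply: vanishesB => //; exact: vanishes_coboundary gu.
- have -> : phi - coboundary g = (phi - coboundary v) - coboundary (g - v).
    by rewrite coboundaryB opprB addrA subrK.
  apply: vanishesB => //; exact: vanishes_coboundary gv.
by exists (g + psi); rewrite coboundaryD opprD addrA.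
Qed.

Lemma mayer_vietoris_inj0 A U V (phi : cochain R T 0) :
  open_cover A U V -> Zc A 0 phi -> Bc U 0 phi -> Bc V 0 phi -> Bc A 0 phi.
Proof. exact: small_cocycle0. Qed.

(** The connecting homomorphism.  Since [z] is a cochain of the whole space,
    its coboundary needs no extension from the intersection to [U]. *)
Lemma mayer_vietoris_connect A U V k (z : cochain R T k) : open_cover A U V ->
  Zc (U `&` V) k z ->
  exists theta, [/\ Zc A k.+1 theta, vanishes U (theta - coboundary z) & vanishes V theta].
Proof.
move=> cov Zz.
have [||w [Zw wz w0]] := glue_cocycles (b := 0) cov (@cocycle_coboundary U _ z).
- exact: cocycle_on0.
- by rewrite subr0.
by exists w; split=> //; rewrite -[w]subr0.
Qed.

End MayerVietoris.

Section HomotopyInvariance.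
Variables (R : realType) (T : topologicalType).
Local Notation Zc A k := (@cocycle_on R T A k).
Local Notation Bc A k := (@coboundary_on R T A k).
Variable H : T * std_simplex R 1 -> T.
Hypothesis H_continuous : continuous H.
Hypothesis H0 : forall x, H (x, vertex R ord0) = x.

Definition pushforward k : singular_simplex R T k -> singular_simplex R T k :=
  @end_map R T H H_continuous ord_max k.

Lemma pushforwardE k (s : singular_simplex R T k) t :
  pushforward s t = H (s t, vertex R ord_max).
Proof.
rewrite /pushforward /end_map /prism_simplex /mkcts /= /prism_map.
by congr (H (s _, _)); [exact: aff_id | exact: aff_cst].
Qed.

Lemma end_map0 k (s : singular_simplex R T k) : end_map H_continuous ord0 s = s.
Proof.
apply/continuousEP => t; rewrite /end_map /prism_simplex /mkcts /= /prism_map -[RHS]H0.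
by congr (H (s _, _)); [exact: aff_id | exact: aff_cst].
Qed.

Definition pullback k (phi : cochain R T k) : cochain R T k :=
  fun s => phi (pushforward s).

Lemma pullback_coboundary k (phi : cochain R T k) :
  pullback (coboundary phi) = coboundary (pullback phi).
Proof.
apply/funext => s; apply: eq_bigr => i _; congr (_ * phi _).
by apply/continuousEP => t; rewrite [RHS]pushforwardE; exact: pushforwardE.
Qed.

Variables A U : set T.
Hypothesis HA : forall x t, A x -> A (H (x, t)).
Hypothesis HAU : forall x, A x -> U (H (x, vertex R ord_max)).

Lemma vanishes_prism k (phi : cochain R T k.+1) : vanishes A phi ->
  vanishes A (prism H_continuous phi).
Proof.
move=> p0 s sA; rewrite /prism.
have -> : prism_pull H_continuous s phi = 0.
  by apply/funext => w; apply: p0 => t; exact: HA (sA _).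
by rewrite cone_homotopy0 // => j; apply/funext => v; rewrite /ends subrr.
Qed.

Lemma pullback_homotopic k (phi : cochain R T k) : Zc A k phi -> Bc A k (pullback phi - phi).
Proof.
move=> Zphi; case: k phi Zphi => [|k] phi Zphi.
  move=> s sA; rewrite -[LHS]/(phi (end_map H_continuous ord_max s) - phi s).
  rewrite -{2}(end_map0 s) prismE0.
  exact: vanishes_prism.
exists (prism H_continuous phi) => s sA.
rewrite -[LHS]/((phi (end_map H_continuous ord_max s) - phi s) -
  coboundary (prism H_continuous phi) s).
rewrite -{2}(end_map0 s) prismE addrAC subrr add0r.
exact: vanishes_prism.
Qed.

Lemma vanishes_pullback k (phi : cochain R T k) : vanishes U phi -> vanishes A (pullback phi).
Proof.
by move=> p0 s sA; apply: p0 => t; rewrite pushforwardE; exact: HAU (sA t).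
Qed.

Lemma pullback_cocycle k (phi : cochain R T k) : Zc U k phi -> Zc A k (pullback phi).
Proof.
by move=> p0; rewrite /cocycle_on /= -pullback_coboundary; exact: vanishes_pullback.
Qed.

(** A deformation of [A], within [A], into [U]. *)
Lemma deformation_inj k (phi : cochain R T k) : Zc A k phi -> Bc U k phi -> Bc A k phi.
Proof.
move=> Zphi Bphi.
have Bp : Bc A k (pullback phi).
  case: k phi {Zphi} Bphi => [|k] phi; first exact: vanishes_pullback.
  case=> e He; exists (pullback e); rewrite -pullback_coboundary.
  exact: vanishes_pullback He.
rewrite -[phi](subKr (pullback phi)); apply: coboundary_onB => //.
exact: pullback_homotopic.
Qed.

End HomotopyInvariance.

(** A deformation of [A] into [U] that preserves [U]. *)
Lemma deformation_surj (R : realType) (T : topologicalType)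
    (H : T * std_simplex R 1 -> T) (A U : set T) : continuous H ->
  (forall x, H (x, vertex R ord0) = x) ->
  (forall x, A x -> U (H (x, vertex R ord_max))) ->
  (forall x t, U x -> U (H (x, t))) ->
  forall k (phi : cochain R T k), cocycle_on U phi ->
  exists2 psi : cochain R T k, cocycle_on A psi & coboundary_on U (psi - phi).
Proof.
move=> Hc H0 HAU HU k phi Zphi; exists (pullback Hc phi).
  exact: pullback_cocycle HAU _ _ Zphi.
exact: pullback_homotopic.
Qed.

(** * Dimensions of quotients and the effect of a puncture *)

Section QuotientDimension.
Variable F : fieldType.

Definition linear_set (V : lmodType F) (S : set V) :=
  S 0 /\ forall a x y, S x -> S y -> S (a *: x + y).

Lemma linear_setB (V : lmodType F) (S : set V) x y :
  linear_set S -> S x -> S y -> S (x - y).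
Proof. by move=> [_ lS] Sx Sy; rewrite addrC -scaleN1r; exact: lS. Qed.

Lemma linear_set_sum (V : lmodType F) (S : set V) n (a : 'I_n -> F) (b : 'I_n -> V) :
  linear_set S -> (forall i, S (b i)) -> S (\sum_i a i *: b i).
Proof.
move=> [S0 lS] Sb; elim/big_ind : _ => // [x y Sx Sy|i _].
  by rewrite -[x]scale1r; exact: lS.
by rewrite -[_ *: _]addr0; exact: lS.
Qed.

(** A linear relation that is total on both sides and well defined and injective
    modulo [B] and [B'] induces an isomorphism of [Z / B] with [Z' / B']. *)
Lemma quotient_dim_relation (V V' : lmodType F) (Z B : set V) (Z' B' : set V')
    (rel : V -> V' -> Prop) d : linear_set Z -> linear_set Z' ->
  rel 0 0 ->
  (forall a x y x' y', rel x x' -> rel y y' -> rel (a *: x + y) (a *: x' + y')) ->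
  (forall z, Z z -> exists2 z', Z' z' & rel z z') ->
  (forall z', Z' z' -> exists2 z, Z z & rel z z') ->
  (forall z z', Z z -> Z' z' -> rel z z' -> B z <-> B' z') ->
  quotient_dim Z B d -> quotient_dim Z' B' d.
Proof.
move=> lZ lZ' rel0 rell totl totr compat [b [Zb Hb]].
have /choice[b' Hb'] : forall i, exists z', Z' z' /\ rel (b i) z'.
  by move=> i; have [z' ? ?] := totl _ (Zb i); exists z'.
exists b'; split=> [i|z' Zz']; first by have [] := Hb' i.
have [z Zz zz'] := totr _ Zz'.
have rels (a : 'I_d -> F) : rel (z - \sum_i a i *: b i) (z' - \sum_i a i *: b' i).
  rewrite addrC [z' - _]addrC -!scaleN1r; apply: (rell) => //.
  elim/big_ind2 : _ => // [x x' y y' xx' yy'|i _].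
    by rewrite -[x]scale1r -[x']scale1r; exact: rell.
  by rewrite -[_ *: b i]addr0 -[_ *: b' i]addr0; apply: (rell) => //; have [] := Hb' i.
have comp a : B (z - \sum_i a i *: b i) <-> B' (z' - \sum_i a i *: b' i).
  apply: compat (rels a); apply: linear_setB => //; apply: linear_set_sum => // i.
  by have [] := Hb' i.
have [a [Ha ua]] := Hb z Zz; exists a; split; first exact/comp.
by move=> c /comp /ua.
Qed.

(** A basis of [Z / B] is made of bases of [K / B] and [Z / K]. *)
Lemma quotient_dim_extension (V : lmodType F) (Z K B : set V) m n :
  linear_set K -> B `<=` K -> K `<=` Z ->
  quotient_dim K B m -> quotient_dim Z K n -> quotient_dim Z B (m + n).
Proof.
move=> lK BK KZ [b [Kb Hb]] [c [Zc Hc]].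
pose e i := match fintype.split i with inl j => b j | inr j => c j end.
have eS (a : {ffun 'I_(m + n) -> F}) : \sum_i a i *: e i =
    \sum_i a (lshift n i) *: b i + \sum_i a (rshift m i) *: c i.
  rewrite big_split_ord /=; congr (_ + _); apply: eq_bigr => i _; rewrite /e.
    by have /= -> := unsplitK (inl i : 'I_m + 'I_n).
  by have /= -> := unsplitK (inr i : 'I_m + 'I_n).
exists e; split=> [i|z Zz]; first by rewrite /e; case: fintype.split => j; [exact: KZ|].
have [g [Kg ug]] := Hc z Zz.
have [f [Bf uf]] := Hb _ Kg.
pose fg : {ffun 'I_(m + n) -> F} :=
  [ffun i => match fintype.split i with inl j => f j | inr j => g j end].
exists fg; split.
  rewrite eS opprD addrCA addrC.
  have -> : \sum_i fg (lshift n i) *: b i = \sum_i f i *: b i.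
    by apply: eq_bigr => i _; rewrite ffunE; have /= -> := unsplitK (inl i : 'I_m + 'I_n).
  have -> : \sum_i fg (rshift m i) *: c i = \sum_i g i *: c i.
    by apply: eq_bigr => i _; rewrite ffunE; have /= -> := unsplitK (inr i : 'I_m + 'I_n).
  by [].
move=> a; rewrite eS => Ba.
have ga : g = [ffun i => a (rshift m i)].
  apply: ug; under eq_bigr do rewrite ffunE.
  have -> : z - \sum_i a (rshift m i) *: c i =
    (z - (\sum_i a (lshift n i) *: b i + \sum_i a (rshift m i) *: c i)) +
    \sum_i a (lshift n i) *: b i.
    by rewrite opprD addrA addrAC subrK.
  rewrite -[X in K (X + _)]scale1r; apply lK; first exact: BK.
  exact: linear_set_sum.
have fa : f = [ffun i => a (lshift n i)].
  apply: uf; rewrite ga.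
  under eq_bigr do rewrite ffunE; under [X in _ - X]eq_bigr do rewrite ffunE.
  by rewrite -addrA -opprD [X in _ - X]addrC.
apply/ffunP => i; rewrite ffunE -[in RHS](splitK i).
by case: fintype.split => j /=; rewrite ?fa ?ga ffunE.
Qed.

Lemma quotient_dim0 (V : lmodType F) (Z B : set V) : Z `<=` B -> quotient_dim Z B 0.
Proof.
move=> ZB; exists (fun=> 0); split=> [[]//|z Zz].
exists [ffun=> 0]; split; first by rewrite big_ord0 subr0; exact: ZB.
by move=> a _; apply/ffunP => -[].
Qed.

End QuotientDimension.

Section AddPuncture.
Variables (R : realType) (T : topologicalType).
Implicit Types A U V : set T.
Local Notation Zc A k := (@cocycle_on R T A k).
Local Notation Bc A k := (@coboundary_on R T A k).

Definition cohomology_dim_on A k d := quotient_dim (Zc A k) (Bc A k) d.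

Definition restriction_inj A U := forall k phi, Zc A k phi -> Bc U k phi -> Bc A k phi.

Definition restriction_surj A U := forall k phi, Zc U k phi ->
  exists2 psi, Zc A k psi & Bc U k (psi - phi).

(** The cocycles on [U] modulo these form the cokernel of [H^k(A) -> H^k(U)]. *)
Definition restricted_classes A U k : set (cochain R T k) :=
  [set phi | exists2 psi, Zc A k psi & Bc U k (phi - psi)].

Lemma linear_cocycles A k : linear_set (Zc A k).
Proof. split; [exact: cocycle_on0 | exact: cocycle_on_linear]. Qed.

Lemma linear_restricted_classes A U k : linear_set (restricted_classes A U (k := k)).
Proof.
split=> [|a x y [x' Zx xx'] [y' Zy yy']].
  by exists 0; rewrite ?subr0; [exact: cocycle_on0|exact: coboundary_on0].
exists (a *: x' + y'); first exact: cocycle_on_linear.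
by rewrite opprD addrACA -scalerBr; exact: coboundary_on_linear.
Qed.

Lemma coboundary_on_congr A k (phi psi : cochain R T k) :
  Bc A k (phi - psi) -> Bc A k phi <-> Bc A k psi.
Proof.
move=> H; split=> p; last by rewrite -[phi](subrK psi); exact: coboundary_onD.
by rewrite -[psi](subKr phi); exact: coboundary_onB.
Qed.

Section Puncture.
Variables A E D : set T.
Hypothesis covA : open_cover A E D.
Hypothesis injAD : restriction_inj A D.

(** By Mayer-Vietoris, a class of [E] that dies on [E `&` D] comes from a class
    of [A] that dies on [D]. *)
Lemma restriction_inj_puncture k (a : cochain R T k) :
  Zc E k a -> Bc (E `&` D) k a -> Bc E k a.
Proof.
move=> Za Ba.
have [w [Zw wE wD]] : exists w, [/\ Zc A k w, Bc E k (w - a) & Bc D k (w - 0)].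
  by apply: mayer_vietoris_glue => //; rewrite ?subr0 //; exact: cocycle_on0.
apply/(coboundary_on_congr wE); apply: (coboundary_on_sub (proj1 (open_cover_sub covA))).
by apply: injAD => //; rewrite -[w]subr0.
Qed.

(** The restriction map is injective by [restriction_inj_puncture]. *)
Lemma dim_restricted_classes k e : cohomology_dim_on E k e ->
  quotient_dim (restricted_classes E (E `&` D) (k := k)) (Bc (E `&` D) k) e.
Proof.
apply: (quotient_dim_relation (rel := fun a phi => Bc (E `&` D) k (phi - a))).
- exact: linear_cocycles.
- exact: linear_restricted_classes.
- by rewrite subrr; exact: coboundary_on0.
- move=> a x y x' y' xx' yy'; rewrite opprD addrACA -scalerBr.
  exact: coboundary_on_linear.
- move=> z Zz; exists z; last by rewrite subrr; exact: coboundary_on0.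
  by exists z => //; rewrite subrr; exact: coboundary_on0.
- by move=> z' [z Zz zz']; exists z.
- move=> z z' Zz _ zz'; split=> [Bz|Bz'].
    by apply/(coboundary_on_congr zz'); exact: coboundary_on_sub Bz.
  apply: restriction_inj_puncture => //; exact/(coboundary_on_congr zz').
Qed.

(** The cokernels of [H(E) -> H(E `&` D)] and of [H(A) -> H(D)] correspond to each
    other: every class of [E `&` D] is a sum of restrictions from [E] and [D],
    because the connecting homomorphism maps to classes of [A] that die on [D]. *)
Lemma dim_new_classes k b :
  quotient_dim (Zc D k) (restricted_classes A D (k := k)) b ->
  quotient_dim (Zc (E `&` D) k) (restricted_classes E (E `&` D) (k := k)) b.
Proof.
have [EA DA] := open_cover_sub covA.
apply: (quotient_dim_relation
  (rel := fun d z => exists2 a, Zc E k a & Bc (E `&` D) k (z - d - a))).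
- exact: linear_cocycles.
- exact: linear_cocycles.
- by exists 0; rewrite ?subrr; [exact: cocycle_on0|exact: coboundary_on0].
- move=> c x y x' y' [a Za aB] [a' Za' aB']; exists (c *: a + a').
    exact: cocycle_on_linear.
  rewrite (_ : _ - _ = c *: (x' - x - a) + (y' - y - a')); first exact: coboundary_on_linear.
  by rewrite !scalerBr !opprD [LHS](AC (2*2*2) ((1*3*5)*(2*4*6))).
- move=> z Zz; exists z; first exact: cocycle_on_sub Zz.
  by exists 0; rewrite ?subrr; [exact: cocycle_on0|exact: coboundary_on0].
- move=> z Zz.
  have [theta [Ztheta thetaE thetaD]] := mayer_vietoris_connect covA Zz.
  have [w Hw] : Bc A k.+1 theta by apply: injAD => //; exact: vanishes_coboundary_on.
  (* as [theta] is [d z] on [E] and zero on [D], its primitive [w] makes [z - w] a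
     cocycle on [E] and is itself one on [D] *)
  exists w.
    rewrite /cocycle_on /= -[coboundary w](subKr theta).
    by apply: vanishesB => //; exact: vanishes_sub Hw.
  exists (z - w); last by rewrite subrr; exact: coboundary_on0.
  rewrite /cocycle_on /= coboundaryB.
  rewrite -[coboundary z](subKr theta) addrAC; apply: vanishesB => //.
  exact: vanishes_sub Hw.
- move=> d z Zd Zz [a Za aB]; split=> [[w Zw wd]|[a' Za' aB']].
    exists (w + a); first by apply: cocycle_onD => //; exact: cocycle_on_sub Zw.
    rewrite (_ : z - _ = (z - d - a) + (d - w)); last by ring.
    apply: coboundary_onD => //; exact: coboundary_on_sub wd.
  have Bad : Bc (E `&` D) k ((a' - a) - d).
    rewrite (_ : _ - _ = (z - d - a) - (z - a')); last by ring.
    exact: coboundary_onB.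
  have [w [Zw _ wd]] := mayer_vietoris_glue covA (cocycle_onB Za' Za) Zd Bad.
  by exists w => //; exact: coboundary_onBC.
Qed.

End Puncture.

End AddPuncture.

(** * The angular classes of a punctured fibre *)

Section AngularClasses.
Variables (R : realType) (T : topologicalType).
Local Notation Zc A k := (@cocycle_on R T A k).
Local Notation Bc A k := (@coboundary_on R T A k).

Variables A D W1 W2 P N : set T.
Hypothesis DA : D `<=` A.
Hypothesis covD : open_cover D W1 W2.
Hypothesis covW : open_cover (W1 `&` W2) P N.
Hypothesis PN : P `&` N = set0.
Hypotheses (injW1 : restriction_inj R A W1) (surjW1 : restriction_surj R A W1).
Hypothesis surjW2 : restriction_surj R A W2.
Hypotheses (injP : restriction_inj R A P) (surjP : restriction_surj R A P).
Hypotheses (injN : restriction_inj R A N) (surjN : restriction_surj R A N).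

Lemma vanishes_set0 k (phi : cochain R T k) : vanishes set0 phi.
Proof. by move=> s s0; have := s0 (centre R k). Qed.

Lemma coboundary_on_set0 k (phi : cochain R T k) : Bc set0 k phi.
Proof. apply: vanishes_coboundary_on; exact: vanishes_set0. Qed.

Let PW : P `<=` W1 `&` W2. Proof. exact: (open_cover_sub covW).1. Qed.
Let NW : N `<=` W1 `&` W2. Proof. exact: (open_cover_sub covW).2. Qed.
Let W1D : W1 `<=` D. Proof. exact: (open_cover_sub covD).1. Qed.
Let W2D : W2 `<=` D. Proof. exact: (open_cover_sub covD).2. Qed.
Let PW1 : P `<=` W1. Proof. by move=> x /PW[]. Qed.
Let PW2 : P `<=` W2. Proof. by move=> x /PW[]. Qed.
Let NW1 : N `<=` W1. Proof. by move=> x /NW[]. Qed.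
Let NW2 : N `<=` W2. Proof. by move=> x /NW[]. Qed.
Let W1A : W1 `<=` A. Proof. exact: subset_trans W1D DA. Qed.
Let W2A : W2 `<=` A. Proof. exact: subset_trans W2D DA. Qed.
Let PA : P `<=` A. Proof. exact: subset_trans PW1 W1A. Qed.

Lemma coboundary_on_disjoint k (phi : cochain R T k) :
  Zc (W1 `&` W2) k phi -> Bc P k phi -> Bc N k phi -> Bc (W1 `&` W2) k phi.
Proof.
case: k phi => [|k] phi Zphi; first exact: mayer_vietoris_inj0 covW Zphi.
move=> [u Hu] [v Hv]; apply: mayer_vietoris_inj covW Zphi Hu Hv _.
by rewrite PN; exact: coboundary_on_set0.
Qed.

Lemma dim_angular_classes0 :
  quotient_dim (Zc D 0) (restricted_classes A D (k := 0)) 0.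
Proof.
apply: quotient_dim0 => phi Zphi.
have [b Zb bphi] := surjW1 (cocycle_on_sub W1D Zphi).
have [c Zc' cphi] := surjW2 (cocycle_on_sub W2D Zphi).
exists b => //; apply: mayer_vietoris_inj0 covD _ _ _.
- by apply: cocycle_onB => //; exact: cocycle_on_sub Zb.
- exact: coboundary_onBC.
have bc : Bc A 0 (b - c).
  apply: injP; first exact: cocycle_onB.
  rewrite -(subrKA phi); apply: coboundary_onD; first exact: coboundary_on_sub bphi.
  by apply: coboundary_onBC; exact: coboundary_on_sub cphi.
rewrite -(subrKA c); apply: coboundary_onD; first exact: coboundary_onBC.
by apply: coboundary_onBC; exact: coboundary_on_sub bc.
Qed.

(** Modulo a class [b] of [A], the class of [phi] is the image under the
    connecting homomorphism of [W1, W2] of the class that is [z] on [P] and zero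
    on [N]. *)
Definition angular_relation k (z : cochain R T k) (phi : cochain R T k.+1) :=
  exists u v b, [/\ Zc A k.+1 b, vanishes W1 (phi - b - coboundary u),
    vanishes W2 (phi - b - coboundary v), Bc P k (u - v - z) & Bc N k (u - v)].

Lemma angular_relation_linear k a (x y : cochain R T k) x' y' :
  angular_relation x x' -> angular_relation y y' ->
  angular_relation (a *: x + y) (a *: x' + y').
Proof.
move=> [u [v [b [Zb H1 H2 H3 H4]]]] [u' [v' [b' [Zb' H1' H2' H3' H4']]]].
exists (a *: u + u'), (a *: v + v'), (a *: b + b'); split.
- exact: cocycle_on_linear.
- rewrite (_ : _ - _ = a *: (x' - b - coboundary u) + (y' - b' - coboundary u')).
    exact: vanishes_linear.
  by rewrite coboundary_linear !scalerBr !opprD [LHS](AC (2*2*2) ((1*3*5)*(2*4*6))).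
- rewrite (_ : _ - _ = a *: (x' - b - coboundary v) + (y' - b' - coboundary v')).
    exact: vanishes_linear.
  by rewrite coboundary_linear !scalerBr !opprD [LHS](AC (2*2*2) ((1*3*5)*(2*4*6))).
- rewrite (_ : _ - _ = a *: (u - v - x) + (u' - v' - y)); first exact: coboundary_on_linear.
  by rewrite !scalerBr !opprD [LHS](AC (2*2*2) ((1*3*5)*(2*4*6))).
- by rewrite opprD addrACA -scalerBr; exact: coboundary_on_linear.
Qed.

Lemma angular_relation_totl k (z : cochain R T k) : Zc A k z ->
  exists2 phi, Zc D k.+1 phi & angular_relation z phi.
Proof.
move=> Zz.
have [|||w [Zw wP wN]] := mayer_vietoris_glue (a := z) (b := 0) covW.
- exact: cocycle_on_sub Zz.
- exact: cocycle_on0.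
- by rewrite PN; exact: coboundary_on_set0.
have [phi [Zphi phi1 phi2]] := mayer_vietoris_connect covD Zw.
exists phi => //; exists w, 0, 0; rewrite !subr0; split=> //.
- exact: cocycle_on0.
- by rewrite coboundary0 subr0.
- by rewrite -[w]subr0.
Qed.

(** The classes of [u - v] on [P] and on [N] are restrictions from [A]; adding to
    [v] the one on [N] makes the latter zero. *)
Lemma angular_relation_totr k (phi : cochain R T k.+1) : Zc D k.+1 phi ->
  exists2 z, Zc A k z & angular_relation z phi.
Proof.
move=> Zphi.
have [b Zb bphi] := surjW1 (cocycle_on_sub W1D Zphi).
have [b' Zb' b'phi] := surjW2 (cocycle_on_sub W2D Zphi).
(* [b] and [b'] both restrict to [phi] on [P], hence are cohomologous on [A] *)
have [c Hc] : Bc A k.+1 (b - b').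
  apply: injP; first exact: cocycle_onB.
  rewrite -(subrKA phi); apply: coboundary_onD; first exact: coboundary_on_sub bphi.
  by apply: coboundary_onBC; exact: coboundary_on_sub b'phi.
have [u Hu] := coboundary_onBC bphi.
have [v Hv] := coboundary_onBC b'phi.
have Hv' : vanishes W2 (phi - b - coboundary (v - c)).
  rewrite coboundaryB (_ : _ - _ = (phi - b' - coboundary v) - (b - b' - coboundary c)).
    by apply: vanishesB => //; exact: vanishes_sub Hc.
  ring.
have Zuv : Zc (W1 `&` W2) k (u - (v - c)).
  rewrite /cocycle_on /= coboundaryB.
  rewrite (_ : _ - _ = (phi - b - coboundary (v - c)) - (phi - b - coboundary u)); last by ring.
  apply: vanishesB; [apply: vanishes_sub Hv'|apply: vanishes_sub Hu];
    [exact: subIsetr|exact: subIsetl].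
have [z1 Zz1 Hz1] := surjP (cocycle_on_sub PW Zuv).
have [z2 Zz2 Hz2] := surjN (cocycle_on_sub NW Zuv).
exists (z1 - z2); first exact: cocycle_onB.
exists u, (v - c + z2), b; split=> //.
- rewrite coboundaryD opprD addrA; apply: vanishesB => //; exact: cocycle_on_sub Zz2.
- rewrite (_ : _ - _ = (u - (v - c)) - z1); last by ring.
  exact: coboundary_onBC.
- rewrite opprD addrA; exact: coboundary_onBC.
Qed.

(** If [z] is a coboundary, then so is [u - v] on both components of
    [W1 `&` W2].  Conversely, if the class of [phi] comes from [A], then [u] and
    [v] can be corrected to cocycles on [W1] and [W2]; their classes come from
    [A] and agree on [N], hence on [A] and on [P]. *)
Lemma angular_relation_compat k (z : cochain R T k) (phi : cochain R T k.+1) :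
  Zc A k z -> Zc D k.+1 phi -> angular_relation z phi ->
  Bc A k z <-> restricted_classes A D phi.
Proof.
move=> Zz Zphi [u [v [b [Zb Hu Hv HP HN]]]]; split=> [Bz|[b0 Zb0 [e He]]].
  exists b => //; apply: (mayer_vietoris_inj covD _ Hu Hv).
    by apply: cocycle_onB => //; exact: cocycle_on_sub Zb.
  have Zuv : Zc (W1 `&` W2) k (u - v).
    rewrite /cocycle_on /= coboundaryB.
    rewrite (_ : _ - _ = (phi - b - coboundary v) - (phi - b - coboundary u)); last by ring.
    by apply: vanishesB; [apply: vanishes_sub Hv|apply: vanishes_sub Hu];
      [exact: subIsetr|exact: subIsetl].
  have HP' : Bc P k (u - v).
    by rewrite -[u - v](subrK z); apply: coboundary_onD => //; exact: coboundary_on_sub Bz.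
  exact: coboundary_on_disjoint.
have Hbu : vanishes W1 (b0 - b - coboundary (u - e)).
  rewrite (_ : _ - _ = (phi - b - coboundary u) - (phi - b0 - coboundary e)).
    by apply: vanishesB => //; exact: vanishes_sub He.
  by rewrite coboundaryB; ring.
have Hbv : vanishes W2 (b0 - b - coboundary (v - e)).
  rewrite (_ : _ - _ = (phi - b - coboundary v) - (phi - b0 - coboundary e)).
    by apply: vanishesB => //; exact: vanishes_sub He.
  by rewrite coboundaryB; ring.
have [c Hc] : Bc A k.+1 (b0 - b).
  by apply: injW1; [exact: cocycle_onB|exists (u - e)].
have Zu : Zc W1 k (u - e - c).
  rewrite /cocycle_on /= coboundaryB.
  rewrite (_ : _ - _ = (b0 - b - coboundary c) - (b0 - b - coboundary (u - e))); last by ring.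
  by apply: vanishesB => //; exact: vanishes_sub Hc.
have Zv : Zc W2 k (v - e - c).
  rewrite /cocycle_on /= coboundaryB.
  rewrite (_ : _ - _ = (b0 - b - coboundary c) - (b0 - b - coboundary (v - e))); last by ring.
  by apply: vanishesB => //; exact: vanishes_sub Hc.
have [x Zx xu] := surjW1 Zu.
have [y Zy yv] := surjW2 Zv.
have Bxy : Bc A k (x - y).
  apply: injN; first exact: cocycle_onB.
  rewrite (_ : _ - _ = (x - (u - e - c)) - (y - (v - e - c)) + (u - v)); last by ring.
  apply: coboundary_onD => //; apply: coboundary_onB;
    [exact: coboundary_on_sub xu|exact: coboundary_on_sub yv].
apply: injP => //.
rewrite (_ : z = (x - y) - (x - (u - e - c)) + (y - (v - e - c)) - (u - v - z)); last by ring.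
apply: coboundary_onB => //; apply: coboundary_onD; last exact: coboundary_on_sub yv.
by apply: coboundary_onB; [exact: coboundary_on_sub Bxy|exact: coboundary_on_sub xu].
Qed.

Lemma dim_angular_classes k h : cohomology_dim_on R A k h ->
  quotient_dim (Zc D k.+1) (restricted_classes A D (k := k.+1)) h.
Proof.
apply: (quotient_dim_relation (rel := @angular_relation k)).
- exact: linear_cocycles.
- exact: linear_cocycles.
- exists 0, 0, 0; split; rewrite ?coboundary0 ?subr0 ?subr0;
    solve [exact: cocycle_on0 | exact: coboundary_on0 | exact: vanishes0].
- exact: angular_relation_linear.
- exact: angular_relation_totl.
- exact: angular_relation_totr.
- exact: angular_relation_compat.
Qed.

End AngularClasses.

Section PunctureDimension.
Variables (R : realType) (T : topologicalType).
Variables A E D W1 W2 P N : set T.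
Hypothesis covA : open_cover A E D.
Hypothesis covD : open_cover D W1 W2.
Hypothesis covW : open_cover (W1 `&` W2) P N.
Hypothesis PN : P `&` N = set0.
Hypothesis injD : restriction_inj R A D.
Hypothesis iso : forall U, U \in [:: W1; W2; P; N] ->
  restriction_inj R A U /\ restriction_surj R A U.

(** The classes of [E `&` D] are those of [E] together with the angular classes
    around the locus removed from [A] by [D]. *)
Lemma cohomology_dim_puncture (h e : nat -> nat) :
  (forall k, cohomology_dim_on R A k (h k)) ->
  (forall k, cohomology_dim_on R E k (e k)) ->
  forall k, cohomology_dim_on R (E `&` D) k (e k + (if k is j.+1 then h j else 0)).
Proof.
move=> hA hE k.
have [EA DA] := open_cover_sub covA.
have [i1 s1] : restriction_inj R A W1 /\ restriction_surj R A W1.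
  by apply: iso; rewrite !inE eqxx.
have [i2 s2] : restriction_inj R A W2 /\ restriction_surj R A W2.
  by apply: iso; rewrite !inE eqxx ?orbT.
have [i3 s3] : restriction_inj R A P /\ restriction_surj R A P.
  by apply: iso; rewrite !inE eqxx ?orbT.
have [i4 s4] : restriction_inj R A N /\ restriction_surj R A N.
  by apply: iso; rewrite !inE eqxx ?orbT.
apply: (quotient_dim_extension (@linear_restricted_classes R T E (E `&` D) k)).
- move=> phi Bphi; exists 0; [exact: cocycle_on0|by rewrite subr0].
- move=> phi [psi Zpsi H]; rewrite -[phi](subrK psi); apply: cocycle_onD.
    exact: coboundary_cocycle.
  exact: cocycle_on_sub Zpsi.
- exact: dim_restricted_classes covA injD _ _ (hE k).
- apply: (dim_new_classes covA injD); case: k => [|k].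
    by apply: dim_angular_classes0 DA covD covW _ _ _.
  by apply: (@dim_angular_classes R T A D W1 W2 P N).
Qed.

End PunctureDimension.

(** * Topology of the complex plane and of sequence spaces *)

Section ComplexTopology.
Variable R : realType.
Local Notation C := (R[i]^o).

Lemma continuous_to_ptws (X : topologicalType) (I : choiceType) (V : topologicalType)
    (f : X -> {ptws I -> V}) :
  (forall i, continuous (fun x => f x i)) -> continuous f.
Proof.
move=> fc x; apply/cvg_sup => i A [_ [[B oB <-] Bfx BA]].
apply: (filterS BA); apply: fc; exact: open_nbhs_nbhs.
Qed.

Lemma continuous_ptws_eval (I : choiceType) (V : topologicalType) (i : I) :
  continuous (fun f : {ptws I -> V} => f i).
Proof.
exact: (@proj_continuous I (fun=> V) i).
Qed.

Lemma Re_continuous : continuous (@complex.Re R : C -> R).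
Proof.
move=> z; apply/(cvgrPdist_lt (FF := nbhs_filter (z : C))) => e e0.
have : \forall w \near z, `|z - w| < e%:C%C.
  by apply: nbhsx_ballx; rewrite ltcR.
apply: filterS => w; rewrite -raddfB /= => H.
by rewrite -ltcR (le_lt_trans (normc_ge_Re _)).
Qed.

Lemma Im_continuous : continuous (@complex.Im R : C -> R).
Proof.
move=> z; apply/(cvgrPdist_lt (FF := nbhs_filter (z : C))) => e e0.
have : \forall w \near z, `|z - w| < e%:C%C.
  by apply: nbhsx_ballx; rewrite ltcR.
apply: filterS => w; rewrite -raddfB /= => H.
rewrite -ltcR (le_lt_trans _ H) //.
have -> : complex.Im (z - w) = complex.Re (- ('i%C * (z - w))).
  by case: (z - w) => a b; simpc.
by apply: (le_trans (normc_ge_Re _)); rewrite normrN normrM normCi mul1r.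
Qed.

Lemma real_complex_continuous : continuous (fun x : R => x%:C%C : C).
Proof.
move=> x; apply/cvgrPdist_lt => e; rewrite ltcE /= => /andP[/eqP e1 e0].
have /cvgrPdist_lt/(_ _ e0) : y @[y --> x] --> x by [].
apply: filterS => y xy; rewrite -raddfB /= normc_def /= expr0n addr0 sqrtr_sqr.
by rewrite ltcE /= e1 eqxx xy.
Qed.

End ComplexTopology.

(** * Configurations of points in the plane *)

Section ConfigurationSpaces.
Variable R : realType.
Local Notation C := (R[i]^o).
Local Notation pts := {ptws nat -> C}.

(** Configurations of [m] distinct points starting with 0 and 1, followed by
    [N - m] unconstrained points; the sequences are cut off at [N] so that for
    [m = N] only the configuration is left. *)
Definition conf (N m : nat) : set pts :=
  [set z | [/\ z 0%N = 0, z 1%N = 1, forall i, (N <= i)%N -> z i = 0 &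
    forall i j, (i < j)%N -> (j < m)%N -> z i <> z j]].

Lemma pt_continuous (i : nat) : continuous (fun z : pts => z i).
Proof. exact: continuous_ptws_eval. Qed.

Lemma pt_fst_continuous (i : nat) (p : pts * std_simplex R 1) :
  {for p, continuous (fun p : pts * std_simplex R 1 => p.1 i)}.
Proof.
apply: (@continuous_comp _ _ _ fst (fun z : pts => z i)); first exact: cvg_fst.
exact: pt_continuous.
Qed.

Lemma segment_continuous (f g : pts * std_simplex R 1 -> C) p :
  {for p, continuous f} -> {for p, continuous g} ->
  {for p, continuous (fun p : pts * std_simplex R 1 =>
    (val p.2 0 ord0)%:C%C * f p + (val p.2 0 ord_max)%:C%C * g p : C)}.
Proof.
move=> fc gc.
have c2 a : {for p, continuous (fun p : pts * std_simplex R 1 => (val p.2 0 a)%:C%C : C)}.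
  apply: (@continuous_comp _ _ _ (fun p : pts * std_simplex R 1 => val p.2 0 a)
    (fun x : R => x%:C%C : C)).
    apply: (@continuous_comp _ _ _ snd (fun t : std_simplex R 1 => val t 0 a)).
      exact: cvg_snd.
    exact: simplex_coord_continuous.
  exact: real_complex_continuous.
apply: (cvgD (FF := nbhs_filter p)).
  exact: (@cvgM R[i] _ _ (nbhs_filter p) _ _ _ _ (c2 ord0) fc).
exact: (@cvgM R[i] _ _ (nbhs_filter p) _ _ _ _ (c2 ord_max) gc).
Qed.

Section MovePoint.
Variables (N m j : nat).
Hypotheses (m2 : (2 <= m)%N) (mN : (m < N)%N) (jm : (j < m)%N).

(** Over each configuration of the other points, [z m - z j] moves straight
    to [c]. *)
Definition move_point (c : C) (p : pts * std_simplex R 1) : pts :=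
  fun i => if i == m then
    (val p.2 0 ord0)%:C%C * p.1 m + (val p.2 0 ord_max)%:C%C * (p.1 j + c) else p.1 i.

Lemma move_point_continuous c : continuous (move_point c).
Proof.
apply: continuous_to_ptws => i; rewrite /move_point.
case: eqP => _ p; last exact: pt_fst_continuous.
apply: (segment_continuous (f := fun p => p.1 m) (g := fun p => p.1 j + c)).
  exact: pt_fst_continuous.
apply: (cvgD (FF := nbhs_filter p)); first exact: pt_fst_continuous.
exact: cvg_cst.
Qed.

Lemma move_point0 c z : move_point c (z, vertex R ord0) = z.
Proof.
apply/funext => i; rewrite /move_point; case: eqP => [->|//] /=.
by rewrite !mxE /= rmorph1 rmorph0 mul1r mul0r addr0.
Qed.

Lemma move_point_conf c z t : conf N m z -> conf N m (move_point c (z, t)).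
Proof.
move=> [z0 z1 zN zd]; rewrite /move_point; split=> /=.
- by rewrite (_ : 0%N == m = false) //; apply/eqP; lia.
- by rewrite (_ : 1%N == m = false) //; apply/eqP; lia.
- by move=> i Ni; rewrite (_ : i == m = false) ?zN //; apply/eqP; lia.
- move=> i l il lm; rewrite (_ : i == m = false); last by apply/eqP; lia.
  by rewrite (_ : l == m = false); [exact: zd|apply/eqP; lia].
Qed.

(** Condition [Q] bears on the real and imaginary parts of [z m - z j]. *)
Definition fibre (Q : R -> R -> Prop) : set pts :=
  [set z | conf N m z /\ Q (complex.Re (z m - z j)) (complex.Im (z m - z j))].

Lemma move_point_diff a b z (t : std_simplex R 1) (w := move_point (a +i* b)%C (z, t)) :
  complex.Re (w m - w j) = val t 0 ord0 * complex.Re (z m - z j) + val t 0 ord_max * a /\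
  complex.Im (w m - w j) = val t 0 ord0 * complex.Im (z m - z j) + val t 0 ord_max * b.
Proof.
rewrite /w /move_point eqxx (_ : j == m = false); last by apply/eqP; lia.
have -> : val t 0 ord0 = 1 - val t 0 ord_max by rewrite -(simplex1_sum t) addrK.
move: (val t 0 ord_max) => s /=.
case: (z m) (z j) => [x1 y1] [x2 y2]; simpc => /=; split; ring.
Qed.

Lemma fibre_inj a b Q : Q a b -> restriction_inj R (conf N m) (fibre Q).
Proof.
move=> Qab k phi; apply: (deformation_inj (move_point_continuous (c := (a +i* b)%C))).
- exact: move_point0.
- by move=> x t; exact: move_point_conf.
- move=> x Ax; split; first exact: move_point_conf.
  have [-> ->] := move_point_diff a b x (vertex R ord_max).
  by rewrite /= !mxE /= !mul0r !mul1r !add0r.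
Qed.

(** The hypothesis says that [Q] defines a region star-shaped around [a + i b]. *)
Lemma fibre_surj a b Q : Q a b ->
  (forall x y s t, 0 <= s -> 0 <= t -> s + t = 1 -> Q x y -> Q (s * x + t * a) (s * y + t * b)) ->
  restriction_surj R (conf N m) (fibre Q).
Proof.
move=> Qab Qstar k phi; apply: (deformation_surj (move_point_continuous (c := (a +i* b)%C))).
- exact: move_point0.
- move=> x Ax; split; first exact: move_point_conf.
  have [-> ->] := move_point_diff a b x (vertex R ord_max).
  by rewrite /= !mxE /= !mul0r !mul1r !add0r.
- move=> x t [Ax Qx]; split; first exact: move_point_conf.
  have [-> ->] := move_point_diff a b x t.
  by apply: Qstar => //; [exact: simplex_ge0|exact: simplex_ge0|exact: simplex1_sum].
Qed.

Lemma open_gt0 (f : pts -> R) : continuous f -> open [set z | 0 < f z].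
Proof.
move=> fc; apply: (@open_comp _ _ f [set x | 0 < x]) => [x _|]; first exact: fc.
exact: open_gt.
Qed.

Lemma Re_diff_continuous i : continuous (fun z : pts => complex.Re (z m - z i)).
Proof.
move=> z; apply: (@continuous_comp _ _ _ (fun z : pts => (z m - z i : C)) (@complex.Re R));
  last exact: Re_continuous.
apply: (cvgB (FF := nbhs_filter z)); exact: pt_continuous.
Qed.

Lemma Im_diff_continuous i : continuous (fun z : pts => complex.Im (z m - z i)).
Proof.
move=> z; apply: (@continuous_comp _ _ _ (fun z : pts => (z m - z i : C)) (@complex.Im R));
  last exact: Im_continuous.
apply: (cvgB (FF := nbhs_filter z)); exact: pt_continuous.
Qed.

Lemma open_lt0 (f : pts -> R) : continuous f -> open [set z | f z < 0].
Proof.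
move=> fc; apply: (@open_comp _ _ f [set x | x < 0]) => [x _|]; first exact: fc.
exact: open_lt.
Qed.

Lemma diff_neq0 (z : pts) i : z i <> z m <->
  complex.Re (z m - z i) != 0 \/ complex.Im (z m - z i) != 0.
Proof.
have -> : (z i <> z m) <-> (z m - z i != 0).
  by split=> [/eqP|]; [rewrite subr_eq0 eq_sym|rewrite subr_eq0 eq_sym => /eqP].
rewrite eq_complex /= negb_and; split; first by move/orP.
by move/orP.
Qed.

Lemma neq0_lt (x : R) : x != 0 <-> 0 < x \/ x < 0.
Proof. by rewrite neq_lt; split=> [/orP|H]; [|apply/orP]; tauto. Qed.

Lemma open_neq i : open [set z : pts | z i <> z m].
Proof.
have -> : [set z : pts | z i <> z m] =
    ([set z | 0 < complex.Re (z m - z i)] `|` [set z | complex.Re (z m - z i) < 0]) `|`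
    ([set z | 0 < complex.Im (z m - z i)] `|` [set z | complex.Im (z m - z i) < 0]).
  apply/funext => z; apply/propext; rewrite /= diff_neq0 !neq0_lt; tauto.
by apply: openU; apply: openU; (apply: open_gt0 || apply: open_lt0);
  (exact: Re_diff_continuous || exact: Im_diff_continuous).
Qed.

Lemma open_neq_lt l : open [set z : pts | forall i, (i < l)%N -> z i <> z m].
Proof.
elim: l => [|l IH].
  have -> : [set z : pts | forall i, (i < 0)%N -> z i <> z m] = setT.
    by apply/seteqP; split.
  exact: openT.
have -> : [set z : pts | forall i, (i < l.+1)%N -> z i <> z m] =
    [set z : pts | forall i, (i < l)%N -> z i <> z m] `&` [set z : pts | z l <> z m].
  apply/seteqP; split=> z /=.
    by move=> H; split=> [i il|]; apply: H; lia.
  move=> [H Hl] i; rewrite ltnS leq_eqVlt => /predU1P[-> //|]; exact: H.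
by apply: openI => //; exact: open_neq.
Qed.

Definition partial_conf l : set pts :=
  conf N m `&` [set z : pts | forall i, (i < l)%N -> z i <> z m].

(* [QD]: the punctured plane; [QW1], [QW2]: the planes slit along a closed real
   half line; [QP], [QN]: the open half planes *)
Let QD (x y : R) := x != 0 \/ y != 0.
Let QW1 (x y : R) := 0 < x \/ y != 0.
Let QW2 (x y : R) := x < 0 \/ y != 0.
Let QP (x y : R) := 0 < y.
Let QN (x y : R) := y < 0.

Lemma fibre_cover Q Q1 Q2 (G1 G2 : set pts) : open G1 -> open G2 ->
  (forall z, Q1 (complex.Re (z m - z j)) (complex.Im (z m - z j)) <->
    Q (complex.Re (z m - z j)) (complex.Im (z m - z j)) /\ G1 z) ->
  (forall z, Q2 (complex.Re (z m - z j)) (complex.Im (z m - z j)) <->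
    Q (complex.Re (z m - z j)) (complex.Im (z m - z j)) /\ G2 z) ->
  (forall x y, Q x y -> Q1 x y \/ Q2 x y) ->
  open_cover (fibre Q) (fibre Q1) (fibre Q2).
Proof.
move=> o1 o2 H1 H2 cov; exists G1, G2; split=> //.
- by apply/seteqP; split=> z /=; rewrite /fibre /= H1; tauto.
- by apply/seteqP; split=> z /=; rewrite /fibre /= H2; tauto.
- by move=> z [_ Qz]; have [/H1[]|/H2[]] := cov _ _ Qz; [left|right].
Qed.

(** The [m]-th point cannot collide with two distinct points at once. *)
Lemma cover_partial_conf : open_cover (conf N m) (partial_conf j) (fibre QD).
Proof.
exists [set z : pts | forall i, (i < j)%N -> z i <> z m], [set z : pts | z j <> z m].
split=> //; [exact: open_neq_lt|exact: open_neq| |].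
  by apply/seteqP; split=> z [Az] /diff_neq0.
move=> z [_ _ _ zd]; have [ze|] := pselect (z j = z m); last by right.
by left=> i ij im; apply: (zd i j) => //; rewrite im.
Qed.

Lemma cover_slit : open_cover (fibre QD) (fibre QW1) (fibre QW2).
Proof.
apply: (@fibre_cover _ _ _
  ([set z | 0 < complex.Re (z m - z j)] `|`
    ([set z | 0 < complex.Im (z m - z j)] `|` [set z | complex.Im (z m - z j) < 0]))
  ([set z | complex.Re (z m - z j) < 0] `|`
    ([set z | 0 < complex.Im (z m - z j)] `|` [set z | complex.Im (z m - z j) < 0]))).
- by apply: openU; [|apply: openU]; (apply: open_gt0 || apply: open_lt0);
  (exact: Re_diff_continuous || exact: Im_diff_continuous).
- by apply: openU; [|apply: openU]; (apply: open_gt0 || apply: open_lt0);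
  (exact: Re_diff_continuous || exact: Im_diff_continuous).
- move=> z /=; rewrite /QW1 /QD !neq0_lt; tauto.
- move=> z /=; rewrite /QW2 /QD !neq0_lt; tauto.
- by move=> x y; rewrite /QD /QW1 /QW2 !neq0_lt; tauto.
Qed.

Lemma slit_inter : fibre QW1 `&` fibre QW2 = fibre (fun _ y => y != 0).
Proof.
apply/seteqP; split=> z /=; rewrite /fibre /QW1 /QW2 /=.
  move=> [[? [x0|?]] [? [x1|?]]]; split=> //.
  by have := lt_trans x0 x1; rewrite ltxx.
tauto.
Qed.

Lemma cover_half : open_cover (fibre QW1 `&` fibre QW2) (fibre QP) (fibre QN).
Proof.
rewrite slit_inter; apply: (@fibre_cover _ _ _ [set z | 0 < complex.Im (z m - z j)]
   [set z | complex.Im (z m - z j) < 0]).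
- by apply: open_gt0; exact: Im_diff_continuous.
- by apply: open_lt0; exact: Im_diff_continuous.
- by move=> z; rewrite /QP neq0_lt /=; tauto.
- by move=> z; rewrite /QN neq0_lt /=; tauto.
- by move=> x y; rewrite neq0_lt /QP /QN; tauto.
Qed.

Lemma half_disjoint : fibre QP `&` fibre QN = set0.
Proof.
apply/seteqP; split=> // z [[_ H] [_ H']].
by have := lt_trans H H'; rewrite ltxx.
Qed.

Lemma partial_confS : partial_conf j `&` fibre QD = partial_conf j.+1.
Proof.
apply/seteqP; split=> z.
  move=> [[Az zj] [_ /diff_neq0 zjm]]; split=> // i.
  by rewrite ltnS leq_eqVlt => /predU1P[-> //|]; exact: zj.
move=> [Az zj]; split; split=> //.
  by move=> i ij; apply: zj; lia.
by apply/diff_neq0; exact: zj.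
Qed.

Lemma convex_gt0 (x s t a : R) : 0 <= s -> 0 <= t -> s + t = 1 -> 0 < x -> 0 < a ->
  0 < s * x + t * a.
Proof.
move=> s0 t0 st x0 a0; have [s1|s1] := eqVneq s 0.
  by rewrite s1 mul0r add0r; move: st; rewrite s1 add0r => ->; rewrite mul1r.
by rewrite ltr_pwDl ?mulr_gt0 ?mulr_ge0 ?(ltW a0) // lt0r s1.
Qed.

Lemma convex_lt0 (x s t a : R) : 0 <= s -> 0 <= t -> s + t = 1 -> x < 0 -> a < 0 ->
  s * x + t * a < 0.
Proof.
move=> s0 t0 st x0 a0; rewrite -oppr_gt0 opprD -!mulrN.
by apply: convex_gt0; rewrite ?oppr_gt0.
Qed.

Lemma slit_star (a x y s t : R) : s + t = 1 -> y != 0 ->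
   s * x + t * a = a \/ s * y + t * 0 != 0.
Proof.
move=> st y0; have [s1|s1] := eqVneq s 0.
  by left; move: st; rewrite s1 mul0r !add0r => ->; rewrite mul1r.
by right; rewrite mulr0 addr0 mulf_neq0.
Qed.

Lemma cohomology_dim_partial_confS (h e : nat -> nat) :
  (forall k, cohomology_dim_on R (conf N m) k (h k)) ->
  (forall k, cohomology_dim_on R (partial_conf j) k (e k)) ->
  forall k, cohomology_dim_on R (partial_conf j.+1) k
    (e k + (if k is i.+1 then h i else 0)).
Proof.
rewrite -partial_confS.
apply: (cohomology_dim_puncture cover_partial_conf cover_slit cover_half half_disjoint).
  by apply: (@fibre_inj 1 0); left; exact: oner_neq0.
move=> U; rewrite !inE => /or4P[] /eqP ->.
- split; [apply: (@fibre_inj 1 0)|apply: (@fibre_surj 1 0)]; try by left.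
  move=> x y s t s0 t0 st [x0|y0]; first by left; exact: convex_gt0.
  by have [->|?] := slit_star 1 x st y0; [left|right].
- split; [apply: (@fibre_inj (-1) 0)|apply: (@fibre_surj (-1) 0)]; try by left; rewrite ltrN10.
  move=> x y s t s0 t0 st [x0|y0]; first by left; apply: convex_lt0; rewrite ?ltrN10.
  by have [->|?] := slit_star (-1) x st y0; [left; rewrite ltrN10|right].
- split; [apply: (@fibre_inj 0 1)|apply: (@fibre_surj 0 1)]; try exact: ltr01.
  by move=> x y s t s0 t0 st y0; exact: convex_gt0.
- split; [apply: (@fibre_inj 0 (-1))|apply: (@fibre_surj 0 (-1))]; try exact: ltrN10.
  by move=> x y s t s0 t0 st y0; apply: convex_lt0; rewrite ?ltrN10.
Qed.

End MovePoint.
End ConfigurationSpaces.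

(** * Betti numbers of the configuration spaces *)

Section PointCohomology.
Variables (R : realType) (T : topologicalType) (p : T).
Local Notation Zc A k := (@cocycle_on R T A k).
Local Notation Bc A k := (@coboundary_on R T A k).

Definition const_simplex k : singular_simplex R T k :=
  mkcts (@cst_continuous (std_simplex R k) T p).

Lemma lies_in_point k (s : singular_simplex R T k) :
  lies_in [set p] s <-> s = const_simplex k.
Proof.
split=> [sp|-> t //]; apply/continuousEP => t; exact: sp.
Qed.

Lemma vanishes_point k (phi : cochain R T k) :
  vanishes [set p] phi <-> phi (const_simplex k) = 0.
Proof.
split=> [H|H s /lies_in_point -> //]; exact/H/lies_in_point.
Qed.

Lemma sum_alternating n : \sum_(i < n) (-1) ^+ i = (odd n)%:R :> rat.
Proof.
elim: n => [|n IH]; first by rewrite big_ord0.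
rewrite big_ord_recr /= IH -signr_odd; case: (odd n) => //=.
Qed.

(** All the faces of a constant simplex are equal, and their signs alternate. *)
Lemma coboundary_point k (phi : cochain R T k) :
  coboundary phi (const_simplex k.+1) = (odd k)%:R * phi (const_simplex k).
Proof.
rewrite /coboundary -[odd k]negbK -[~~ odd k]/(odd k.+1) -[~~ _]/(odd k.+2) -sum_alternating.
rewrite mulr_suml; by apply: eq_bigr => i _; congr (_ * phi _); apply/continuousEP.
Qed.

Lemma cohomology_dim_point k : cohomology_dim_on R [set p] k (k == 0)%N.
Proof.
case: k => [|k].
  exists (fun _ => (fun=> 1) : cochain R T 0); split=> [i|phi _].
    by apply/vanishes_point; rewrite coboundary_point mul0r.
  have E (a : {ffun 'I_1 -> rat}) :
      (phi - \sum_i a i *: ((fun=> 1) : cochain R T 0)) (const_simplex 0) =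
      phi (const_simplex 0) - a ord0.
    by rewrite big_ord1 -[LHS]/(phi (const_simplex 0) - a ord0 * 1) mulr1.
  exists [ffun=> phi (const_simplex 0)]; split.
    by apply/vanishes_point; rewrite E ffunE subrr.
  move=> a /vanishes_point; rewrite E => /eqP; rewrite subr_eq0 => /eqP ->.
  by apply/ffunP => i; rewrite ffunE (ord1 i).
apply: quotient_dim0 => phi /vanishes_point; rewrite coboundary_point => H.
have [ok|ok] := boolP (odd k).
  exists (fun=> phi (const_simplex k.+1)); apply/vanishes_point.
  rewrite -[LHS]/(phi _ - coboundary _ _) coboundary_point ok mul1r.
  exact: subrr.
apply: vanishes_coboundary_on; apply/vanishes_point.
by move: H; rewrite /= ok mul1r.
Qed.

End PointCohomology.

Lemma cohomology_dim_restriction (R : realType) (T : topologicalType) (A U : set T) k d :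
  U `<=` A -> restriction_inj R A U -> restriction_surj R A U ->
  cohomology_dim_on R U k d -> cohomology_dim_on R A k d.
Proof.
move=> UA inj surj.
apply: (quotient_dim_relation (rel := fun z a => coboundary_on U (a - z))).
- exact: linear_cocycles.
- exact: linear_cocycles.
- by rewrite subrr; exact: coboundary_on0.
- move=> a x y x' y' xx' yy'; rewrite opprD addrACA -scalerBr.
  exact: coboundary_on_linear.
- by move=> z /surj.
- move=> a Za; exists a; first exact: cocycle_on_sub Za.
  by rewrite subrr; exact: coboundary_on0.
- move=> z a Zz Za za; split=> [Bz|Ba].
    by apply: inj => //; apply/(coboundary_on_congr za).
  by apply/(coboundary_on_congr za); exact: coboundary_on_sub Ba.
Qed.

Section ConfigurationCohomology.
Variable R : realType.
Local Notation C := (R[i]^o).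
Local Notation pts := {ptws nat -> C}.

Definition base_conf : pts := fun i => if i == 1%N then 1 else 0.

Definition line_to_base (q : pts * std_simplex R 1) : pts :=
  fun i => (val q.2 0 ord0)%:C%C * q.1 i + (val q.2 0 ord_max)%:C%C * base_conf i.

Lemma line_to_base_continuous : continuous line_to_base.
Proof.
apply: continuous_to_ptws => i p.
apply: (segment_continuous (f := fun p => p.1 i) (g := fun=> base_conf i)).
  exact: pt_fst_continuous.
exact: (@cst_continuous _ C (base_conf i) p).
Qed.

Lemma line_to_base0 z : line_to_base (z, vertex R ord0) = z.
Proof.
apply/funext => i; rewrite /line_to_base /=.
by rewrite !mxE /= rmorph1 rmorph0 mul1r mul0r addr0.
Qed.

Lemma line_to_base1 z : line_to_base (z, vertex R ord_max) = base_conf.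
Proof.
apply/funext => i; rewrite /line_to_base /=.
by rewrite !mxE /= rmorph1 rmorph0 mul1r mul0r add0r.
Qed.

Lemma line_to_base_coord z t i : z i = base_conf i -> line_to_base (z, t) i = base_conf i.
Proof.
move=> e; rewrite /line_to_base /= e -mulrDl -rmorphD /=.
by rewrite simplex1_sum rmorph1 mul1r.
Qed.

(** The configurations of two points form an affine space. *)
Lemma cohomology_dim_conf2 N k : (2 <= N)%N -> cohomology_dim_on R (@conf R N 2) k (k == 0)%N.
Proof.
move=> N2; have base2 : @conf R N 2 base_conf.
  split=> // [i Ni|[|i] [|[|l]]] //.
    by rewrite /base_conf; case: i Ni => [|[|i]] //; lia.
  by move=> _ _ /eqP; rewrite /base_conf /= eq_sym oner_eq0.
have HA x t : @conf R N 2 x -> @conf R N 2 (line_to_base (x, t)).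
  move=> [z0 z1 zN zd].
  have e0 : line_to_base (x, t) 0%N = 0 by rewrite line_to_base_coord.
  have e1 : line_to_base (x, t) 1%N = 1 by rewrite line_to_base_coord.
  split=> // [i Ni|[|i] [|[|l]]] //.
    have bi : base_conf i = 0.
      by rewrite /base_conf; case: i Ni => [|[|i]] //; lia.
    by rewrite line_to_base_coord // zN.
  by move=> _ _ /eqP; rewrite e0 e1 eq_sym oner_eq0.
apply: (@cohomology_dim_restriction R _ _ [set base_conf]).
- by move=> _ ->.
- move=> j phi; apply: (deformation_inj line_to_base_continuous).
  + exact: line_to_base0.
  + exact: HA.
  + by move=> x _; exact: line_to_base1.
- move=> j phi; apply: (deformation_surj line_to_base_continuous).
  + exact: line_to_base0.
  + by move=> x _; exact: line_to_base1.
  + by move=> x t ->; apply/funext => i; rewrite line_to_base_coord.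
exact: cohomology_dim_point.
Qed.

(** Each of the [j] collisions already forbidden has added [dim H^(k-1)]. *)
Lemma cohomology_dim_partial_conf N m (h : nat -> nat) : (2 <= m)%N -> (m < N)%N ->
  (forall k, cohomology_dim_on R (@conf R N m) k (h k)) ->
  forall j, (j <= m)%N -> forall k, cohomology_dim_on R (@partial_conf R N m j) k
    (h k + j * (if k is i.+1 then h i else 0)).
Proof.
move=> m2 mN hm; elim=> [|j IH] jm k.
  rewrite mul0n addn0 (_ : @partial_conf R N m 0 = @conf R N m) //.
  by apply/seteqP; split=> [z []|z].
rewrite mulSn addnCA addnC.
exact: (cohomology_dim_partial_confS m2 mN jm hm (IH (ltnW jm))).
Qed.

Lemma partial_conf_full N m : @partial_conf R N m m = @conf R N m.+1.
Proof.
apply/seteqP; split=> z.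
  move=> [[z0 z1 zN zd] zm]; split=> // i j ij; rewrite ltnS leq_eqVlt => /predU1P[jm|].
    by rewrite jm; apply: zm; rewrite -jm.
  exact: zd.
move=> [z0 z1 zN zd]; split; first by split=> // i j ij jm; apply: zd => //; exact: ltnW.
by move=> i im; apply: zd.
Qed.

Lemma cohomology_dim_conf N n : (n.+2 <= N)%N -> forall k,
  cohomology_dim_on R (@conf R N n.+2) k
    ((\prod_(1 <= i < n.+1) (1 + (i + 1)%:R *: 'X) : {poly nat})`_k)%R.
Proof.
elim: n => [|n IH] nN k.
  by rewrite big_geq // coef1 natn; exact: cohomology_dim_conf2.
rewrite -partial_conf_full big_nat_recr //=.
set p := (\prod_(_ <= _ < _) _)%R.
have -> : ((p * (1 + (n.+1 + 1)%:R *: 'X))`_k)%R =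
    ((p`_k)%R + n.+2 * (if k is i.+1 then (p`_i)%R else 0))%N.
  rewrite mulrDr mulr1 coefD; congr (_ + _)%N.
  by rewrite -scalerAr coefZ coefMX natn addn1; case: k.
exact: (cohomology_dim_partial_conf _ nN (IH (ltnW nN)) (leqnn _) k).
Qed.

End ConfigurationCohomology.

(** * The toric arrangement of type A *)

Section Transfer.
Variables (R : realType) (X T : topologicalType) (A : set T) (h : X -> T).
Hypothesis h_continuous : continuous h.
Hypothesis hA : forall x, A (h x).
Hypothesis h_inj : injective h.
Hypothesis h_lift : forall k (s : singular_simplex R T k), lies_in A s ->
  exists t : singular_simplex R X k, forall x, h (t x) = s x.

Definition push_simplex k (t : singular_simplex R X k) : singular_simplex R T k :=
  mkcts h_continuous \o t.

Lemma lies_in_push k (t : singular_simplex R X k) : lies_in A (push_simplex t).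
Proof. by move=> x; exact: hA. Qed.

Lemma push_lift k (s : singular_simplex R T k) : lies_in A s ->
  exists t : singular_simplex R X k, push_simplex t = s.
Proof. by move=> /h_lift[t ht]; exists t; apply/continuousEP. Qed.

Lemma push_inj k : injective (@push_simplex k).
Proof.
move=> t t' /continuousEP e; apply/continuousEP => x; apply: h_inj; exact: e.
Qed.

Lemma push_face k (t : singular_simplex R X k.+1) i :
  push_simplex (simplex_face i t) = simplex_face i (push_simplex t).
Proof. exact/continuousEP. Qed.

Definition pull_cochain k (phi : cochain R T k) : cochain R X k :=
  fun t => phi (push_simplex t).

Lemma pull_cochain_coboundary k (phi : cochain R T k) :
  pull_cochain (coboundary phi) = coboundary (pull_cochain phi).
Proof. by apply/funext => t; apply: eq_bigr => i _; rewrite -push_face. Qed.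

Lemma pull_cochain_surj k (psi : cochain R X k) :
  exists phi : cochain R T k, pull_cochain phi = psi.
Proof.
exists (fun s => if pselect (exists t, push_simplex t = s) is left e
                 then psi (projT1 (cid e)) else 0).
apply/funext => t; rewrite /pull_cochain; case: pselect => [e|[]]; last by exists t.
by congr psi; apply: push_inj; exact: projT2 (cid e).
Qed.

Lemma pull_cochain_eq0 k (phi : cochain R T k) : pull_cochain phi = 0 <-> vanishes A phi.
Proof.
split=> [p0 s /push_lift[t <-]|p0]; first by rewrite -[LHS]/(pull_cochain phi t) p0.
by apply/funext => t; apply: p0; exact: lies_in_push.
Qed.

(** Cohomology only sees singular simplices, so that an injection [h] through
    which every simplex of [A] factors has the effect of a homeomorphism of [X]
    onto [A]. *)
Lemma cohomology_dim_transfer k d : cohomology_dim_on R A k d -> cohomology_dim R X k d.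
Proof.
apply: (quotient_dim_relation (rel := fun phi psi => psi = pull_cochain phi)).
- exact: linear_cocycles.
- split; first by rewrite /cocycles /=; exact: coboundary0.
  by move=> a x y; rewrite /cocycles /= coboundary_linear => -> ->; rewrite scaler0 addr0.
- by [].
- by move=> a x y _ _ -> ->.
- move=> phi Zphi; exists (pull_cochain phi) => //.
  by rewrite /cocycles /= -pull_cochain_coboundary; apply/pull_cochain_eq0.
- move=> psi Zpsi; have [phi e] := pull_cochain_surj psi; exists phi => //.
  by apply/pull_cochain_eq0; rewrite pull_cochain_coboundary e.
- move=> phi psi Zphi _ ->; case: k phi psi Zphi => [|k] phi _ _ /=.
    by split=> [/pull_cochain_eq0|/pull_cochain_eq0].
  split=> [[e /pull_cochain_eq0 He]|[e _ He]].
    exists (pull_cochain e) => //; rewrite -pull_cochain_coboundary.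
    by apply/esym/eqP; rewrite -subr_eq0; apply/eqP.
  have [e' ee'] := pull_cochain_surj e; exists e'; apply/pull_cochain_eq0.
  rewrite -[LHS]/(pull_cochain phi - pull_cochain (coboundary e')).
  by rewrite pull_cochain_coboundary ee' He subrr.
Qed.

End Transfer.

Section TypeA.
Variables (R : realType) (n : nat).
Local Notation C := (R[i]^o).
Local Notation Phi := (root_system_A R n).
Local Notation L := (Zspan Phi).
Local Notation pts := {ptws nat -> C}.

Lemma diff_in_Zspan (i j : 'I_n.+1) :
  (delta_mx 0 i - delta_mx 0 j : 'rV[R]_n.+1) \in in_Zspan Phi.
Proof.
apply/asboolP; have [->|ij] := eqVneq i j.
  exists 0%N, (fun=> 0), (fun=> 0); split=> [[]//|]; by rewrite big_ord0 subrr.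
exists 1%N, (fun=> delta_mx 0 i - delta_mx 0 j), (fun=> 1%:Z); split.
  by move=> _; exists i, j.
by rewrite big_ord1 mulr1z.
Qed.

(** The case [i = j] is included so that the elements [e_i - e_0] are indexed by
    all [i]. *)
Definition root_pair (i j : 'I_n.+1) : L := MkZspan (diff_in_Zspan i j).

Lemma rootB i j : root_pair i j = root_pair i ord0 - root_pair j ord0.
Proof. by apply: val_inj; rewrite raddfB /= opprB addrA subrK. Qed.

(** The point of index [i + 1] is the value at [e_i - e_0]; thus the point of
    index 1 is the value 1 at [e_0 - e_0]. *)
Definition coordinates (chi : X_A R n) : pts :=
  fun i => if i is i'.+1 then
      if (i' < n.+1)%N then val chi (root_pair (inord i') ord0) else 0
    else 0.

Lemma coordinates_continuous : continuous coordinates.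
Proof.
apply: continuous_to_ptws => -[|i]; first exact: cst_continuous.
rewrite /coordinates; case: (i < n.+1)%N; last exact: cst_continuous.
move=> chi; apply: (@continuous_comp _ _ _ set_val
  (fun f : {ptws L -> C} => f (root_pair (inord i) ord0))).
  exact: initial_continuous.
exact: continuous_ptws_eval.
Qed.

Lemma torusP (chi : X_A R n) : torus (val chi).
Proof. by have [] := set_mem (valP chi). Qed.

Lemma torus0 (chi : {ptws L -> C}) : torus chi -> chi 0 = 1.
Proof.
move=> [nz add]; apply: (mulIf (nz 0)).
by rewrite -add addr0 mul1r.
Qed.

Lemma torusB (chi : {ptws L -> C}) x y : torus chi -> chi (x - y) = chi x / chi y.
Proof.
move=> ct; have [nz add] := ct.
by apply: (mulIf (nz y)); rewrite -add subrK divfK.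
Qed.

Lemma torus_mulz (chi : {ptws L -> C}) x (c : int) : torus chi -> chi (x *~ c) = chi x ^ c.
Proof.
move=> ct; have [nz add] := ct.
have nat_case m : chi (x *+ m) = chi x ^+ m.
  elim: m => [|m IH]; first by rewrite mulr0n torus0.
  by rewrite mulrS add IH exprS.
case: c => m; first exact: nat_case.
rewrite NegzE mulrNz -[X in chi X]add0r torusB // torus0 // div1r.
by rewrite -exprnN; congr (_^-1); exact: nat_case.
Qed.

(** A character is determined by its values on the roots, which are differences
    of the elements [e_i - e_0]. *)
Lemma coordinates_inj : injective coordinates.
Proof.
move=> chi chi' e; apply: val_inj; apply/funext => x.
have ct := torusP chi; have ct' := torusP chi'.
have er0 i : val chi (root_pair i ord0) = val chi' (root_pair i ord0).
  have := congr1 (fun f => f i.+1) e.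
  by rewrite /coordinates ltn_ord inord_val.
have er i j : val chi (root_pair i j) = val chi' (root_pair i j).
  by rewrite rootB !torusB // !er0.
case: x => v vin; have := vin => /asboolP[m [a [c [aP ve]]]].
have /choice[b Hb] : forall i, exists y : L, val y = a i /\ val chi y = val chi' y.
  by move=> i; have [p [q [_ ->]]] := aP i; exists (root_pair p q).
have -> : MkZspan vin = \sum_(i < m) b i *~ c i.
  apply: val_inj; rewrite raddf_sum -[LHS]/v ve; apply: eq_bigr => i _.
  by rewrite raddfMz; congr (_ *~ _); exact: esym (proj1 (Hb i)).
elim/big_ind : _ => [|y z ey ez|i _]; first by rewrite !torus0.
  by rewrite ct.2 ct'.2 ey ez.
by rewrite !torus_mulz //; have [_ ->] := Hb i.
Qed.

(** The coordinates of the elements of the root lattice are integers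
    ([weightK]), so that taking the floor only changes their type. *)
Definition weight (x : L) (i : 'I_n.+1) : int := Num.floor (val x 0 i).

Lemma weightK x i : (weight x i)%:~R = val x 0 i.
Proof.
apply: floorK; case: x => v vin; rewrite -[val _]/v.
move: vin => /asboolP[m [a [c [aP ->]]]].
rewrite summxE; apply: rpred_sum => l _.
have [p [q [_ ->]]] := aP l.
rewrite -scaler_int !mxE rpredM ?rpred_int // rpredB //.
  by rewrite rpred_nat.
by rewrite rpred_nat.
Qed.

Lemma weightD x y i : weight (x + y) i = weight x i + weight y i.
Proof.
apply: (@intr_inj R); rewrite intrD !weightK /=.
by rewrite mxE.
Qed.

Lemma weight_root p q i : weight (root_pair p q) i = (i == p)%:Z - (i == q)%:Z.
Proof.
apply: (@intr_inj R); rewrite weightK intrD /= !mxE eqxx /=.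
by rewrite intrN -!pmulrn.
Qed.

(** The character with value [z (i + 1) / z (j + 1)] at [e_i - e_j]. *)
Definition character_of (z : pts) : {ptws L -> C} :=
  fun x => \prod_(i < n.+1) z i.+1 ^ weight x i.

Lemma prod_indicator (z : pts) (p : 'I_n.+1) :
  \prod_(i < n.+1) z i.+1 ^ (i == p)%:Z = z p.+1.
Proof.
rewrite (bigD1 p) //= eqxx expr1z big1 ?mulr1 // => i /negPf ->.
by rewrite expr0z.
Qed.

Lemma character_of_root z p q : (forall i : 'I_n.+1, z i.+1 != 0) ->
  character_of z (root_pair p q) = z p.+1 / z q.+1.
Proof.
move=> nz; rewrite /character_of.
under eq_bigr => i _ do rewrite weight_root expfzDr // -invr_expz.
by rewrite big_split /= prodfV !prod_indicator.
Qed.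

Lemma conf_neq0 z (i : 'I_n.+1) : @conf R n.+2 n.+2 z -> z i.+1 != 0.
Proof.
move=> [z0 _ _ zd]; apply/eqP => zi.
by have /(_ isT (ltn_ord i)) := zd 0%N i.+1; rewrite z0 zi.
Qed.

Lemma character_of_complement z : @conf R n.+2 n.+2 z ->
  character_of z \in toric_complement R Phi.
Proof.
move=> cz; have nz i := conf_neq0 i cz; apply/mem_set; split.
  split=> [x|x y]; first by apply/prodf_neq0 => i _; exact: expfz_neq0.
  rewrite /character_of -big_split /=; apply: eq_bigr => i _.
  by rewrite weightD expfzDr.
move=> [a [p [q [pq ae]]] [_]].
have -> : a = root_pair p q by apply: val_inj.
rewrite character_of_root // => /(canRL (divfK (nz q))); rewrite mul1r.
case: cz => _ _ _ zd.
have : val p != val q by [].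
rewrite neq_ltn => /orP[lt|lt].
  by apply: zd; rewrite ltnS.
by move/esym; apply: zd; rewrite ltnS.
Qed.

Lemma coordinates_conf chi : @conf R n.+2 n.+2 (coordinates chi).
Proof.
have ct := torusP chi.
have c1 (i : 'I_n.+1) : coordinates chi i.+1 = val chi (root_pair i ord0).
  by rewrite /coordinates ltn_ord inord_val.
have cn i (lin : (i < n.+1)%N) : coordinates chi i.+1 = val chi (root_pair (Ordinal lin) ord0).
  by rewrite -c1.
split=> //.
- rewrite (c1 ord0) (_ : root_pair _ _ = 0) ?torus0 //.
  by apply: val_inj; rewrite /= subrr.
- by move=> [|i] //; rewrite ltnS => ni; rewrite /coordinates ltnNge ni.
move=> [|i] [|j] // ij jn; have {}jn : (j < n.+1)%N by [].
  by rewrite (cn _ jn) => /esym/eqP; apply/negP; exact: ct.1.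
have {}ij : (i < j)%N by [].
have lin := ltn_trans ij jn; rewrite (cn _ jn) (cn _ lin) => e.
have [_ H] := set_mem (valP chi).
apply: H; exists (root_pair (Ordinal lin) (Ordinal jn)).
  exists (Ordinal lin), (Ordinal jn); split=> //.
  by rewrite -val_eqE /= ltn_eqF.
split=> //; rewrite rootB torusB // e divff //; exact: ct.1.
Qed.

Lemma coordinatesK z (cz : @conf R n.+2 n.+2 z) :
  coordinates (exist _ (character_of z) (character_of_complement cz)) = z.
Proof.
have nz i := conf_neq0 i cz; have [z0 z1 zN _] : @conf R n.+2 n.+2 z by [].
apply/funext => -[|i] //=; rewrite /coordinates.
case: ltnP => lin; last by rewrite zN.
rewrite character_of_root // z1 divr1.
by rewrite inordK.
Qed.

Lemma expz_continuous (X : topologicalType) (f : X -> C) (m : int) x :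
  {for x, continuous f} -> f x != 0 -> {for x, continuous (fun y => f y ^ m : C)}.
Proof.
move=> fc fx0.
have pow l : {for x, continuous (fun y => f y ^+ l : C)}.
  elim: l => [|l IH]; first exact: cvg_cst.
  rewrite (_ : (fun y => _) = (fun y => f y * f y ^+ l)).
    exact: (@cvgM R[i] _ _ (nbhs_filter x) _ _ _ _ fc IH).
  by apply/funext => y; rewrite exprS.
case: m => m; first exact: pow.
apply: (@cvgV R[i] _ _ (nbhs_filter x) _ _ _ (pow m.+1)).
by rewrite expf_neq0.
Qed.

Lemma coordinates_lift k (s : singular_simplex R pts k) :
  lies_in (@conf R n.+2 n.+2) s ->
  exists t : singular_simplex R (X_A R n) k, forall x, coordinates (t x) = s x.
Proof.
move=> sA.
pose t x : X_A R n := exist _ (character_of (s x)) (character_of_complement (sA x)).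
have tc : continuous t.
  apply: continuous_comp_initial; apply: continuous_to_ptws => w x.
  rewrite /= /character_of.
  apply: (@cvg_big _ _ _ _ _ _ _ _ _ _ _ (nbhs_filter x)) => [|i _].
    exact: mul_continuous.
  have sc : {for x, continuous (fun y => s y i.+1)}.
    apply: (@continuous_comp _ _ _ s (fun z : pts => z i.+1)); first exact: cts_fun.
    exact: pt_continuous.
  exact: (@expz_continuous _ (fun y => s y i.+1) (weight w i) x sc (conf_neq0 i (sA x))).
by exists (mkcts tc) => x; exact: coordinatesK.
Qed.

End TypeA.

Theorem theorem1p2 (R : realType) (n : nat) (hn : (1 <= n)%N) :
  is_poincare_polynomial R (X_A R n)
    (\prod_(1 <= i < n.+1) (1 + (i + 1)%:R *: 'X)).
Proof.
move=> k.
apply: (cohomology_dim_transfer (@coordinates_continuous R n)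
  (@coordinates_conf R n) (@coordinates_inj R n) (@coordinates_lift R n)).
exact: cohomology_dim_conf.
Qed.
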